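(* Let $(t,y_1,y_2)$ be a random vector whose probability density is proportional to $t$ on the set $$\{(t,y_1,y_2)\in\mathbb R^3:\ t>0,\ t^2\le y_1^2+y_2^2+1/t^2,\ 2|y_1|\le t,\ 2|y_2|\le t\}$$ and zero elsewhere, set $$\xi_R=\frac{y_1}{\sqrt{y_1^2+y_2^2+1/t^2}},\qquad \xi_I=\frac{y_2}{\sqrt{y_1^2+y_2^2+1/t^2}},$$ and let $\xi=(\xi_R^2+\xi_I^2)^{1/2}$. Then $\xi$ has probability density function $$-\frac{6\,\xi}{C(1-\xi^2)^2}\Big(\chi_{0<\xi<1/2}\Big(\frac\pi2\log\xi+C\Big)+\chi_{1/2<\xi<1/\sqrt2}\int_{\arccos(1/(2\xi))}^{\pi/4}\log(4\xi^2\cos^2\theta)\,d\theta\Big),$$ where $C=\sum_{n=1}^\infty\frac{(-1)^{n-1}}{(2n-1)^2}$ is Catalan's constant.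
   Context: $\chi_A$ equals $1$ if $A$ holds and $0$ otherwise. Interpretation: for a random lattice from $\mathrm{SL}_2(\mathbb C)/\mathrm{SL}_2(\mathbb Z[i])$ with shortest reduced basis $\{\boldsymbol\alpha,\boldsymbol\beta\}$ over the Gaussian integers, written in Gram–Schmidt coordinates $\boldsymbol\alpha=(t,0)$, $\boldsymbol\beta=(y_1+iy_2,1/t)$, the invariant measure gives $(t,y_1,y_2)$ the stated density, and $\xi=|\overline{\boldsymbol\alpha}\cdot\boldsymbol\beta|/(\|\boldsymbol\alpha\|\,\|\boldsymbol\beta\|)$. *)

(* Defs.v *)
From HB Require Import structures.
From mathcomp Require Export all_boot all_order all_algebra.
From mathcomp Require Export all_classical all_reals all_analysis.

Set Implicit Arguments.
Unset Strict Implicit.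
Unset Printing Implicit Defensive.

Import Order.TTheory GRing.Theory Num.Theory.
Import numFieldNormedType.Exports.

Local Open Scope classical_set_scope.
Local Open Scope ring_scope.

Definition has_density (R : realType) (d d' : measure_display)
    (T : measurableType d) (U : measurableType d') (P : probability T R)
    (mu : {measure set U -> \bar R}) (X : T -> U) (f : U -> R) : Prop :=
  [/\ measurable_fun [set: T] X,
      measurable_fun [set: U] f,
      (forall u, 0 <= f u) &
      forall A : set U, measurable A ->
        P (X @^-1` A) = (\int[mu]_(u in A) (f u)%:E)%E].

Definition leb3 (R : realType) :
    {measure set ((measurableTypeR R * measurableTypeR R)
                  * measurableTypeR R) -> \bar R} :=
  ((@lebesgue_measure R \x @lebesgue_measure R) \x @lebesgue_measure R)%E.

(* A point of R^3 is a nested pair ((t, y1), y2). *)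
Definition lattice_domain (R : realType) : set (R * R * R) :=
  [set u | let t := u.1.1 in let y1 := u.1.2 in let y2 := u.2 in
    [/\ 0 < t,
        t ^+ 2 <= y1 ^+ 2 + y2 ^+ 2 + 1 / t ^+ 2,
        2 * `|y1| <= t &
        2 * `|y2| <= t]].

Definition xiR (R : realType) (t y1 y2 : R) : R :=
  y1 / Num.sqrt (y1 ^+ 2 + y2 ^+ 2 + 1 / t ^+ 2).

Definition xiI (R : realType) (t y1 y2 : R) : R :=
  y2 / Num.sqrt (y1 ^+ 2 + y2 ^+ 2 + 1 / t ^+ 2).

Definition xi (R : realType) (t y1 y2 : R) : R :=
  Num.sqrt (xiR t y1 y2 ^+ 2 + xiI t y1 y2 ^+ 2).

Definition catalan (R : realType) : R :=
  limn (fun N : nat =>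
    \sum_(1 <= n < N.+1) (-1) ^+ n.-1 / (2 * n%:R - 1) ^+ 2 : R).

(* Outside the range cut out by an indicator, the factor it multiplies may
   involve [ln] or [acos] outside their natural domains; these are total
   functions, so the product is still 0. *)
Definition xi_density (R : realType) (x : R) : R :=
  - (6 * x / (catalan R * (1 - x ^+ 2) ^+ 2)) *
    ((0 < x < 1 / 2)%R%:R * (pi / 2 * ln x + catalan R)
     + (1 / 2 < x < 1 / Num.sqrt 2)%R%:R *
       (\int[@lebesgue_measure R]_(theta in `[acos (1 / (2 * x)), pi / 4])
          ln (4 * x ^+ 2 * cos theta ^+ 2))).

(* Main.v *)
From HB Require Import structures.
Require Import Defs.
From mathcomp Require Import all_boot all_order all_algebra.
From mathcomp Require Import all_classical all_reals all_analysis.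
From mathcomp Require Import measurable_realfun ring lra.
Import Order.TTheory GRing.Theory Num.Theory.
Import numFieldNormedType.Exports.
Local Open Scope classical_set_scope.
Local Open Scope ring_scope.

(** Let m(A) be the mass that the measure t dt dy1 dy2 gives to the part of
    the domain where xi lies in A ([lattice_mass]).  The law of xi is
    A |-> c m(A), and c = 1 / m(R), so that both the mass in xi and the total
    mass have to be computed.

    Reduction to a logarithmic integral.  For fixed t, the condition
    t^2 <= |beta|^2 and the value of xi depend on (y1, y2) only through
    p = y1^2 + y2^2, and (y1, y2) ranges over a square centred at 0.  The
    square is cut into eight triangles, and slopes v = y2 / y1 in ]0, 1] are
    used as an angular coordinate: for a given v, p runs through
    ]0, (1 + v^2) t^2 / 4] ([integral_slice]).  Passing from p to
    x = xi, that is, p = x^2 / (t^2 (1 - x^2)), the constraints become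
      x^2 / (1 - x^2) <= (1 + v^2) / 4 * t^4   and   t^4 <= 1 / (1 - x^2)
    ([slice_general]).  Integrating in t first, which Tonelli's theorem
    permits, the density in t is a multiple of 1 / t, and a quarter of the
    positive part of ln ((1 + v^2) / (4 x^2)) comes out.  Hence
    ([lattice_massE])
      m(A) = integral of 2 x / (1 - x^2)^2 * L(x) over A and ]0, 1[,
      L(x) = integral over ]0, 1] of ln^+((1 + v^2) / (4 x^2)) / (1 + v^2) dv.
    With v = tan theta, L(x) is the integral of the positive part of
    - ln (4 x^2 cos^2 theta) over ]0, pi/4].  It vanishes when
    x >= 1 / sqrt 2; the positive part restricts theta to
    [acos (1 / (2 x)), pi/4] when 1/2 < x < 1 / sqrt 2 ([logslope_mid]), and it
    has no effect when x < 1/2, where L(x) = - (pi/2 ln x + C)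
    ([logslope_low]).

    Total mass.  Taking q = p / t^2 in place of x and again integrating in t
    first gives m(R) as the integral over ]0, 1] of
    ln (4 / (3 - v^2)) / (1 + v^2) ([lattice_massT]); it equals C / 3, so that
    c = 3 / C ([lattice_massT_catalan]).

    The logarithmic integrals.  Let K be the primitive of ln (2 cos x) on
    ]-pi/2, pi/2[ with K(0) = 0 (Clausen's function in disguise).  The
    duplication and triplication formulas of the cosine integrate to formulas
    for K ([log_cosine_duplication], [log_cosine_triplication]), which evaluate
    both integrals in terms of K(pi/4) ([integral_ln_oneDsqr],
    [integral_ln_threeBsqr]).  Finally C = 2 K(pi/4) ([catalan_log_cosine]):
    K(atan v) + K(pi/2 - atan v) and Ti(v) - atan v ln v, where Ti is the
    inverse tangent integral, have the same derivative and the same limit 0 at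
    v = 0; their values at v = 1 are 2 K(pi/4) and C.  The proof compares with
    the partial sums of the power series of Ti and atan, with an explicit
    error. *)

(** * Derivatives and limits of explicit functions *)

Lemma oneDsqr_pos {R : realType} (v : R) : 0 < 1 + v ^+ 2.
Proof. by rewrite ltr_pwDl// sqr_ge0. Qed.
#[local] Hint Extern 0 (is_true (0 < _ + _)) => exact: oneDsqr_pos : core.

Section derivation.
Context {R : realType}.
Implicit Types (f g : R -> R) (x a b : R).

Lemma is_derive1V f x a : is_derive x 1 f a -> f x != 0 ->
  is_derive x 1 (fun y => (f y)^-1) (- a / f x ^+ 2).
Proof.
move=> fa fx0; apply: DeriveDef.
  exact: derivableV.
rewrite (@deriveV _ _ _ _ _ fx0)// derive_val /GRing.scale/=; field.
by [].
Qed.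

Lemma is_derive1_fun_comp f g x a b : is_derive (g x) 1 f a ->
  is_derive x 1 g b -> is_derive x 1 (fun y => f (g y)) (a * b).
Proof. by move=> ? ?; exact: is_derive1_comp. Qed.

Lemma is_derive1_ln_comp g x b : is_derive x 1 g b -> 0 < g x ->
  is_derive x 1 (fun y => ln (g y)) (b / g x).
Proof.
move=> gb gx0; rewrite mulrC; apply: (is_derive1_fun_comp (@ln R)) => //.
exact: is_derive1_ln.
Qed.

Lemma is_derive1_divr f x a (k : R) : is_derive x 1 f a ->
  is_derive x 1 (fun y => f y / k) (a / k).
Proof.
move=> fa; have -> : (fun y => f y / k) = k^-1 \*: f.
  by apply/funext => y; rewrite /GRing.scale/= mulrC.
by rewrite mulrC; exact: is_deriveZ.
Qed.

Lemma is_derive1_bigsum n (h : nat -> R -> R) (dh : nat -> R) x :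
  (forall i, is_derive x 1 (h i) (dh i)) ->
  is_derive x 1 (fun y => \sum_(i < n) h i y) (\sum_(i < n) dh i).
Proof.
move=> dhx; have -> : (fun y => \sum_(i < n) h i y) = \sum_(i < n) h i.
  by apply/funext => y; rewrite fct_sumE.
by apply: is_derive_sum => i; exact: dhx.
Qed.

Lemma is_derive1_cast f x a b : is_derive x 1 f a -> a = b ->
  is_derive x 1 f b.
Proof. by move=> ? <-. Qed.

End derivation.

Section composition_limits.
Context {R : realType} {T : Type} {F : set_system T} {FF : Filter F}.
Implicit Types (f : T -> R) (a : R).

Lemma cvg_exprn f a n : f x @[x --> F] --> a -> f x ^+ n @[x --> F] --> a ^+ n.
Proof.
exact: (@continuous_cvg _ R R F _ f (fun y => y ^+ n) a (@exprn_continuous R n a)).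
Qed.

Lemma cvg_ln f a : 0 < a -> f x @[x --> F] --> a -> ln (f x) @[x --> F] --> ln a.
Proof.
by move=> a0; exact: (@continuous_cvg _ R R F _ f (@ln R) a (continuous_ln a0)).
Qed.

Lemma cvg_cos f a : f x @[x --> F] --> a -> cos (f x) @[x --> F] --> cos a.
Proof. exact: (@continuous_cvg _ R R F _ f cos a (@continuous_cos R a)). Qed.

End composition_limits.

(* The head symbol of the function selects the lemma: trying them one after
   the other would have failing unifications unfold [ln] or [cos]. *)
Ltac continuity_step :=
  lazymatch goal with |- cvg_to ?F _ =>
  lazymatch F with context [fmap ?f _] =>
  lazymatch f with
  | (fun _ => ?c) => exact: cvg_cst
  | (fun y => y) => exact: cvg_id
  | (fun _ => _ * _) => apply: cvgM
  | (fun _ => _ + _) => apply: cvgD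
  | (fun _ => - _) => apply: cvgN
  | (fun _ => _ ^-1) => apply: cvgV
  | (fun _ => _ ^+ _) => apply: cvg_exprn
  | (fun _ => ln _) => apply: cvg_ln
  | (fun _ => cos _) => apply: cvg_cos
  (* eta-reduced functions *)
  | GRing.mul _ => apply: cvgM
  | @GRing.opp _ => apply: cvgN
  | @cos _ => exact: continuous_cos
  end end end.
Ltac continuity_tac := repeat continuity_step.

Arguments is_derive1V {R f x a}.
Arguments is_derive1_fun_comp {R f g x a b}.
Arguments is_derive1_ln_comp {R g x b}.
Arguments is_derive1_cast {R f x a b}.
Arguments is_derive1_divr {R f x a}.
Arguments is_derive1_bigsum {R} n {h dh x}.

(** * Change of variable for the measure of a set *)

Section ftc_interval.
Context {R : realType}.
Local Notation mu := (@lebesgue_measure R).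
Variables (F f : R -> R) (a b : R).
Hypothesis ab : a <= b.
Hypothesis dF : {in `[a, b], forall x : R, is_derive x 1 F (f x)}.
Hypothesis cf : {in `[a, b], forall x : R, {for x, continuous f}}.

Lemma within_continuous_pt (g : R -> R) :
  {in `[a, b], forall x : R, {for x, continuous g}} -> {within `[a, b], continuous g}.
Proof.
by move=> cg; apply: continuous_in_subspaceT => x; rewrite inE; exact: cg.
Qed.

Lemma derive_pt_continuous : {in `[a, b], forall x : R, {for x, continuous F}}.
Proof.
by move=> x /dF dFx; apply/differentiable_continuous/derivable1_diffP.
Qed.

Lemma integral_itv_cc_ftc : (\int[mu]_(x in `[a, b]) (f x)%:E = (F b - F a)%:E)%E.
Proof.
move: ab; rewrite le_eqVlt => /predU1P[ab0|ab0].
  by rewrite ab0 set_itv1 integral_set1 subrr.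
apply: continuous_FTC2 => //.
- exact: within_continuous_pt.
- split.
  + by move=> x /subset_itv_oo_cc xab; have := dF x xab => ?; exact: ex_derive.
  + by apply/cvg_at_right_filter/derive_pt_continuous; rewrite in_itv/= lexx.
  + by apply/cvg_at_left_filter/derive_pt_continuous; rewrite in_itv/= lexx ab.
- move=> x /subset_itv_oo_cc xab; have := dF x xab => ?.
  by rewrite derive1E derive_val.
Qed.

Lemma integral_itv_bnd_ftc b0 b1 :
  (\int[mu]_(x in [set` Interval (BSide b0 a) (BSide b1 b)]) (f x)%:E = (F b - F a)%:E)%E.
Proof.
have mf : measurable_fun (`]a, b[ : set R) (EFin \o f).
  apply/measurable_EFinP; apply: (@measurable_funS _ _ _ _ `[a, b]) => //.
    exact: subset_itv_oo_cc.
  apply: subspace_continuous_measurable_fun => //.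
  exact: within_continuous_pt.
by rewrite -integral_itv_cc_ftc integral_itv_bndoo// [RHS]integral_itv_bndoo.
Qed.
End ftc_interval.

Section image_measure.
Context {R : realType}.
Local Notation mu := (@lebesgue_measure R).
Variables (F f : R -> R) (a b : R).
Hypothesis ab : a <= b.
Hypothesis dF : {in `[a, b], forall x : R, is_derive x 1 F (f x)}.
Hypothesis cf : {in `[a, b], forall x : R, {for x, continuous f}}.
Hypothesis f0 : {in `[a, b], forall x : R, 0 <= f x}.
Hypothesis incF : {in `[a, b] &, {mono F : x y / x <= y}}.

Let mF : measurable_fun (`]a, b] : set R) F.
Proof.
apply: (@measurable_funS _ _ _ _ `[a, b]) => //; first exact: subset_itv_oc_cc.
apply: subspace_continuous_measurable_fun => //.
by apply: within_continuous_pt; exact: derive_pt_continuous dF.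
Qed.

Let mf : measurable_fun (`]a, b] : set R) (EFin \o f).
Proof.
apply/measurable_EFinP.
apply: (@measurable_funS _ _ _ _ `[a, b]) => //; first exact: subset_itv_oc_cc.
by apply: subspace_continuous_measurable_fun => //; exact: within_continuous_pt.
Qed.

Definition image_measure (B : set (measurableTypeR R)) : \bar R :=
  (\int[mu]_(x in `]a, b] `&` F @^-1` B) (f x)%:E)%E.

Let image_measure0 : image_measure set0 = 0%E.
Proof. by rewrite /image_measure preimage_set0 setI0 integral_set0. Qed.

Let image_measure_ge0 B : (0 <= image_measure B)%E.
Proof.
apply: integral_ge0 => x [xab _]; rewrite lee_fin f0//.
exact: subset_itv_oc_cc.
Qed.

Let image_measure_sigma_additive : semi_sigma_additive image_measure.
Proof.
move=> /= G mG tG mUG; rewrite /image_measure; apply: cvg_toP.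
  apply: ereal_nondecreasing_is_cvgn => m n mn.
  by apply: lee_sum_nneg_natr => // k _ _; exact: image_measure_ge0.
rewrite preimage_bigcup setI_bigcupr ge0_integral_bigcup//=.
- by move=> k; apply: mF => //; exact: (mG k).
- apply: measurable_funS mf => //; rewrite -setI_bigcupr; exact: subIsetl.
- move=> x [k _ [xab _]]; rewrite lee_fin f0//; exact: subset_itv_oc_cc.
- by move=> i j _ _ [x [[_ Gi] [_ Gj]]]; apply: tG => //; exists (F x).
Qed.

HB.instance Definition _ := isMeasure.Build _ _ _ image_measure
  image_measure0 image_measure_ge0 image_measure_sigma_additive.

Let image_measure_itv (X : set R) : ocitv X ->
  image_measure X = mu (X `&` `]F a, F b]).
Proof.
move=> [[p q] _ <-] /=; have [qp|pq] := leP q p.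
  by rewrite set_itv_ge ?bnd_simp -?leNgt// set0I image_measure0 measure0.
have FaFb : F a <= F b by rewrite incF// in_itv/= lexx ab.
have aab : a \in `[a, b] by rewrite in_itv/= lexx ab.
have bab : b \in `[a, b] by rewrite in_itv/= lexx ab.
(* Only the part of ]p, q] inside ]F a, F b] has preimages: [clamp] moves the
   end points to the nearest values of F. *)
pose clamp r := Num.min (Num.max (F a) r) (F b).
have clampP r : exists2 c, c \in `[a, b] & F c = clamp r.
  apply: IVT => //; first by apply: within_continuous_pt; exact: derive_pt_continuous dF.
  rewrite (min_l FaFb) (max_r FaFb) /clamp; apply/andP; split.
    by rewrite le_min FaFb le_max lexx.
  by rewrite ge_min lexx orbT.
have [al alab Fal] := clampP p; have [be beab Fbe] := clampP q.
have albe : al <= be.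
  by rewrite -incF// Fal Fbe le_min2// le_max2// ltW.
have clampE r x : x \in `]a, b] -> (F x <= r) = (F x <= clamp r).
  move=> xab; have xab' : x \in `[a, b] by exact: subset_itv_oc_cc.
  have /andP[ax xb] : a < x <= b by move: xab; rewrite in_itv.
  rewrite /clamp le_min le_max !incF// xb andbT.
  by rewrite (leNgt x a) ax.
have -> : image_measure `]p, q] = (\int[mu]_(x in `]al, be]) (f x)%:E)%E.
  rewrite /image_measure; congr (integral _ _ _).
  apply/seteqP; split=> x /=.
  - move=> [xab]; rewrite in_itv/= => /andP[pF Fq].
    have xab' : x \in `[a, b] by exact: subset_itv_oc_cc.
    rewrite in_itv/=; apply/andP; split.
      by rewrite ltNge -incF// Fal -clampE// -ltNge.
    by rewrite -incF// Fbe -clampE.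
  - rewrite in_itv/= => /andP[alx xbe].
    have xab : x \in `]a, b].
      rewrite in_itv/= (le_lt_trans _ alx) ?(itvP alab)//=.
      by rewrite (le_trans xbe) ?(itvP beab).
    have xab' : x \in `[a, b] by exact: subset_itv_oc_cc.
    split=> //; rewrite in_itv/=; apply/andP; split.
      by rewrite ltNge clampE// -Fal incF// -ltNge.
    by rewrite clampE// -Fbe incF.
have sub : {subset `[al, be] <= `[a, b]}.
  move=> x; rewrite !in_itv/= => /andP[alx xbe].
  by rewrite (le_trans _ alx) ?(itvP alab)//= (le_trans xbe) ?(itvP beab).
rewrite (@integral_itv_bnd_ftc _ F f _ _ albe); last 2 first.
- by move=> x /sub; exact: dF.
- by move=> x /sub; exact: cf.
have -> : `]p, q] `&` `]F a, F b] = `]F al, F be]%classic.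
  apply/seteqP; split => x /=; rewrite Fal Fbe !in_itv/=.
    move=> [/andP[px xq] /andP[ax xb]]; rewrite /clamp gt_min gt_max ax px/=.
    by rewrite le_min le_max xq orbT xb.
  move=> /andP[]; rewrite /clamp gt_min gt_max le_min le_max.
  move=> /orP[/andP[ax px]|bx] /andP[/orP[xa|xq] xb].
  - by rewrite leNgt ax in xa.
  - by rewrite px ax xb xq.
  - by rewrite leNgt bx in xb.
  - by rewrite leNgt bx in xb.
rewrite lebesgue_measure_itv/= lte_fin -EFinB; case: ltP => // Fba.
by apply/congr1/eqP; rewrite subr_eq0 eq_le Fba incF.
Qed.

(** Both sides are measures in B, finite on bounded intervals.  They agree on
    half-open intervals by the fundamental theorem of calculus, hence on all
    Borel sets.  The derivative may vanish, as that of a square does at 0. *)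
Theorem integral_indic_image (B : set R) : measurable B ->
  (\int[mu]_(x in `]a, b]) (f x * \1_B (F x))%:E = mu (B `&` `]F a, F b]))%E.
Proof.
move=> mB.
have <- : image_measure B = mu (B `&` `]F a, F b]).
  pose m2 := mrestr mu (measurable_itv `]F a, F b]).
  have := @measure_unique _ R (measurableTypeR R) (@ocitv R)
    (fun n => `](- n%:R), n%:R]%classic) _ _ _ _ image_measure m2 _ _ B mB.
  apply => //.
  - exact: ocitvI.
  - by move=> n; exact: is_ocitv.
  - exact: bigcup_itvT.
  - move=> k; have := image_measure_itv _ (@is_ocitv R (- k%:R) k%:R); rewrite /= => ->.
    apply: (@le_lt_trans _ _ (mu `]F a, F b])); first exact: measureIr.
    by rewrite lebesgue_measure_itv/=; case: ifP => // _; rewrite -EFinB ltry.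
rewrite /image_measure integral_mkcondr; apply: eq_integral => x _.
rewrite patchE indicE.
have [xB|xB] := boolP (x \in F @^-1` B).
  by move: (xB); rewrite inE/= => FxB; rewrite mem_set// mulr1.
by rewrite memNset ?mulr0// => FxB; move/negP: xB; apply; rewrite inE.
Qed.

End image_measure.

(** * Tonelli's theorem on rectangles and measurability *)

Section tonelli.
Context {d1 d2 : measure_display} {T1 : measurableType d1}
  {T2 : measurableType d2} {R : realType}.
Variables (m1 : {sigma_finite_measure set T1 -> \bar R})
  (m2 : {sigma_finite_measure set T2 -> \bar R}).
Variables (A : set T1) (B : set T2) (f : T1 -> T2 -> \bar R).
Hypotheses (mA : measurable A) (mB : measurable B).
Hypothesis f0 : forall x y, A x -> B y -> (0 <= f x y)%E.
Hypothesis mf : measurable_fun [set: T1 * T2] (fun z => f z.1 z.2).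

Let g := (fun z => f z.1 z.2) \_ (A `*` B).

Let mg : measurable_fun setT g.
Proof.
apply/(measurable_restrictT _ _).1; first exact: measurableX.
exact: measurable_funTS.
Qed.

Let g0 z : (0 <= g z)%E.
Proof.
by rewrite /g patchE; case: ifPn => //; rewrite inE => -[Ax By]; exact: f0.
Qed.

Let gl x : (\int[m2]_y g (x, y))%E = ((fun x => \int[m2]_(y in B) f x y) \_ A)%E x.
Proof.
rewrite patchE; case: ifPn => xA.
  rewrite [RHS]integral_mkcond; apply: eq_integral => y _.
  rewrite /g !patchE; congr (if _ then _ else _).
  by apply/idP/idP; rewrite !inE/=; [case|move: xA; rewrite inE].
apply: integral0_eq => y _; rewrite /g patchE ifN//.
by apply/negP; rewrite inE/= => -[/mem_set xA']; rewrite xA' in xA.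
Qed.

Let gr y : (\int[m1]_x g (x, y))%E = ((fun y => \int[m1]_(x in A) f x y) \_ B)%E y.
Proof.
rewrite patchE; case: ifPn => yB.
  rewrite [RHS]integral_mkcond; apply: eq_integral => x _.
  rewrite /g !patchE; congr (if _ then _ else _).
  by apply/idP/idP; rewrite !inE/=; [case|move: yB; rewrite inE].
apply: integral0_eq => x _; rewrite /g patchE ifN//.
by apply/negP; rewrite inE/= => -[_ /mem_set yB']; rewrite yB' in yB.
Qed.

Lemma tonelli_in : (\int[m1]_(x in A) \int[m2]_(y in B) f x y =
  \int[m2]_(y in B) \int[m1]_(x in A) f x y)%E.
Proof.
have := @fubini_tonelli _ _ _ _ _ m1 m2 g mg g0.
under eq_integral do rewrite gl.
under [X in _ = X -> _]eq_integral do rewrite gr.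
by rewrite -!integral_mkcond.
Qed.

Lemma measurable_integral_in :
  measurable_fun A (fun x => \int[m2]_(y in B) f x y)%E.
Proof.
apply/(measurable_restrictT _ _).2 => //.
have := @measurable_fun_fubini_tonelli_F _ _ _ _ _ m2 g mg g0.
by apply: eq_measurable_fun => x _; rewrite /fubini_F gl.
Qed.

End tonelli.

Section even_integral.
Context {R : realType}.
Local Notation mu := (@lebesgue_measure R).

Lemma integral_even (g : R -> \bar R) : measurable_fun setT g ->
  (forall x, 0 <= g x)%E -> (forall x, g (- x) = g x) ->
  (\int[mu]_x g x = 2%:E * \int[mu]_(x in `]0%R, +oo[) g x)%E.
Proof.
move=> mg g0 gN.
have -> : [set: R] = `]-oo, (0 : R)] `|` `](0 : R), +oo[.
  by apply/seteqP; split => x //= _; rewrite !in_itv/= andbT; case: leP; [left|right].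
rewrite ge0_integral_setU//=; last 2 first.
- exact: measurable_funTS.
- apply/disj_setPS => x [] /=; rewrite !in_itv/= andbT => x0.
  by rewrite ltNge x0.
rewrite mule_natl mule2n; congr (_ + _)%E.
rewrite [RHS]integral_itv_obnd_cbnd; last exact: measurable_funTS.
by rewrite ge0_integration_by_substitution0//; apply: eq_integral => x _; rewrite gN.
Qed.

End even_integral.

Section measurable_tools.
Context {R : realType}.

Lemma measurable_invr : measurable_fun [set: R] (fun x : R => x^-1).
Proof.
have -> : [set: R] = [set 0] `|` ~` [set 0] by rewrite setUv.
apply/measurable_funU; [exact: measurable_set1|exact: measurableC|split].
  exact: measurable_fun_set1.
apply: open_continuous_measurable_fun; first
    exact/closed_openC/accessible_closed_set1/hausdorff_accessible/Rhausdorff.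
by move=> x; rewrite inE/= => /eqP x0; exact: inv_continuous.
Qed.

Lemma measurable_sqrtr : measurable_fun [set: R] (@Num.sqrt R).
Proof. by apply: continuous_measurable_fun; exact: sqrt_continuous. Qed.

Lemma measurable_indic_comp d (T : measurableType d) (E : set R) (D : set T)
    (f : T -> R) : measurable E -> measurable_fun D f ->
  measurable_fun D (fun x => \1_E (f x) : R).
Proof.
by move=> mE mf; apply: (measurable_comp measurableT) => //.
Qed.

Lemma measurable_natr_bool d (T : measurableType d) (D : set T) (b : T -> bool) :
  measurable_fun D b -> measurable_fun D (fun x => (b x)%:R : R).
Proof.
by move=> mb; apply: (@measurableT_comp _ _ _ _ bool R (fun b => b%:R)).
Qed.

End measurable_tools.

(* Dispatch on the head symbol, for the same reason as [continuity_step]. *)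
Ltac measurability_step :=
  lazymatch goal with |- measurable_fun _ ?f =>
  lazymatch f with
  | (fun _ => ?c) => exact: measurable_cst
  | (fun x => x) => exact: measurable_id
  | (fun x => EFin (@?g x)) => apply/(@measurable_EFinP _ _ _ _ g)
  | (fun _ => _ * _) => apply: measurable_funM
  | (fun _ => _ + _) => apply: measurable_funD
  | (fun _ => - _) => apply: measurable_funN
  | (fun _ => _ ^+ _) => apply: measurable_funX
  | (fun _ => _ ^-1) => apply: (measurableT_comp measurable_invr)
  | (fun _ => Num.sqrt _) => apply: (measurableT_comp measurable_sqrtr)
  | (fun _ => ln _) => apply: (measurableT_comp (@measurable_ln _))
  | (fun _ => `|_|) => apply: (measurableT_comp (@normr_measurable _ setT))
  | (fun _ => _.1) => apply: (measurableT_comp measurable_fst)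
  | (fun _ => _.2) => apply: (measurableT_comp measurable_snd)
  | (fun _ => \1__ _) => apply: measurable_indic_comp; [assumption|]
  | (fun _ => (nat_of_bool _)%:R) => apply: measurable_natr_bool
  | (fun _ => _ && _) => apply: measurable_and
  | (fun _ => _ <= _) => apply: measurable_fun_ler
  | (fun _ => _ < _) => apply: measurable_fun_ltr
  (* eta-reduced sections *)
  | Order.lt _ => apply: measurable_fun_ltr
  | GRing.mul _ => apply: measurable_funM
  | @GRing.inv _ => exact: measurable_invr
  end end.
Ltac measurability_tac := repeat measurability_step.

(** * Radial functions on a square, in the slope coordinate *)

Section polar.
Context {R : realType}.
Local Notation mu := (@lebesgue_measure R).
Variables (E : set R) (h : R).
Hypotheses (mE : measurable E) (h0 : 0 < h).

Let I (y z : R) : \bar R := (\1_E (y ^+ 2 + z ^+ 2))%:E.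

Let I0 y z : (0 <= I y z)%E.
Proof. by rewrite lee_fin. Qed.

Let mI : measurable_fun [set: R * R] (fun u => I u.1 u.2).
Proof. by rewrite /I; measurability_tac. Qed.

Let mI1 y : measurable_fun [set: R] (I y).
Proof. by rewrite /I; measurability_tac. Qed.

Lemma integral_square_quarter :
  (\int[mu]_y \int[mu]_z
     (((`|y| <= h) && (`|z| <= h))%:R * \1_E (y ^+ 2 + z ^+ 2))%:E =
   4%:E * \int[mu]_(y in `]0%R, h]) \int[mu]_(z in `]0%R, h]) I y z)%E.
Proof.
pose J y z : \bar R := (((`|y| <= h) && (`|z| <= h))%:R * \1_E (y ^+ 2 + z ^+ 2))%:E.
have J0 y z : (0 <= J y z)%E by rewrite lee_fin mulr_ge0// ler0n.
have mJ : measurable_fun [set: R * R] (fun u => J u.1 u.2).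
  by rewrite /J; measurability_tac.
have mJ1 y : measurable_fun [set: R] (J y).
  by rewrite /J; measurability_tac.
have half y : (0 < y)%R -> (\int[mu]_z J y z = 2%:E *
    \int[mu]_(z in `]0%R, h]) ((y <= h)%R%:R%:E * I y z))%E.
  move=> y0; rewrite integral_even//; last first.
    by move=> z; rewrite /J normrN sqrrN.
  congr (_ * _)%E; rewrite integral_mkcond [RHS]integral_mkcond.
  apply: eq_integral => z _; rewrite !patchE !mem_setE !in_itv/= andbT.
  case: ltP => //= z0; rewrite /J !gtr0_norm//.
  by case: (leP z h) => zh; rewrite ?andbT ?andbF ?mul0r// EFinM.
rewrite integral_even; last 3 first.
- exact: (@measurable_integral_in _ _ _ _ _ mu setT setT J).
- by move=> y; exact: integral_ge0.
- by move=> y; apply: eq_integral => z _; rewrite normrN sqrrN.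
transitivity (2%:E * (2%:E * \int[mu]_(y in `]0%R, h]) \int[mu]_(z in `]0%R, h]) I y z))%E; last first.
  by rewrite muleA -EFinM; congr ((_ %:E) * _)%E; ring.
congr (_ * _)%E; rewrite -ge0_integralZl//; last 2 first.
- exact: measurable_integral_in.
- by move=> y _; exact: integral_ge0.
rewrite [LHS]integral_mkcond [RHS]integral_mkcond.
apply: eq_integral => y _; rewrite !patchE !mem_setE !in_itv/= andbT.
case: ltP => //= y0; rewrite half//; case: leP => yh.
  by congr (_ * _)%E; apply: eq_integral => z _; rewrite mul1e.
by rewrite integral0_eq ?mule0// => z _; rewrite mul0e.
Qed.

(** The two triangles on either side of the diagonal are exchanged by swapping
    the variables. *)
Lemma integral_quarter_triangle :
  (\int[mu]_(y in `]0%R, h]) \int[mu]_(z in `]0%R, h]) I y z =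
   2%:E * \int[mu]_(y in `]0%R, h]) \int[mu]_(z in `]0%R, y]) I y z)%E.
Proof.
pose L y z : \bar R := ((z <= y)%R%:R * \1_E (y ^+ 2 + z ^+ 2))%:E.
pose U y z : \bar R := ((y < z)%R%:R * \1_E (y ^+ 2 + z ^+ 2))%:E.
have L0 y z : (0 <= L y z)%E by rewrite lee_fin mulr_ge0// ler0n.
have U0 y z : (0 <= U y z)%E by rewrite lee_fin mulr_ge0// ler0n.
have mL : measurable_fun [set: R * R] (fun u => L u.1 u.2).
  by rewrite /L; measurability_tac.
have mU : measurable_fun [set: R * R] (fun u => U u.1 u.2).
  by rewrite /U; measurability_tac.
have mL1 y : measurable_fun [set: R] (L y) by rewrite /L; measurability_tac.
have mU1 y : measurable_fun [set: R] (U y) by rewrite /U; measurability_tac.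
have split_I y : (\int[mu]_(z in `]0%R, h]) I y z =
    \int[mu]_(z in `]0%R, h]) L y z + \int[mu]_(z in `]0%R, h]) U y z)%E.
  rewrite -ge0_integralD//; last 2 first.
  - exact: measurable_funTS (mL1 y).
  - exact: measurable_funTS (mU1 y).
  apply: eq_integral => z _; rewrite /L /U /I -EFinD -mulrDl.
  by case: leP; rewrite /= ?add0r ?addr0 mul1r.
under eq_integral do rewrite split_I.
rewrite ge0_integralD//; last 4 first.
- by move=> y _; exact: integral_ge0.
- exact: measurable_integral_in.
- by move=> y _; exact: integral_ge0.
- exact: measurable_integral_in.
rewrite [X in (_ + X)%E](@tonelli_in _ _ _ _ _ mu mu)//.
rewrite mule_natl mule2n; congr (_ + _)%E; apply: eq_integral => y.
  rewrite mem_setE in_itv/= => /andP[y0 yh].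
  rewrite [LHS]integral_mkcond [RHS]integral_mkcond.
  apply: eq_integral => z _; rewrite !patchE !mem_setE !in_itv/= /L /I.
  case: (leP z y) => [zy|yz]; rewrite ?(le_trans zy yh) ?andbT ?andbF ?mul1r//.
  by rewrite mul0r; case: ifP.
rewrite mem_setE in_itv/= => /andP[y0 yh].
rewrite -[RHS]integral_itv_bndo_bndc; last exact: measurable_funTS (mI1 y).
rewrite [LHS]integral_mkcond [RHS]integral_mkcond.
apply: eq_integral => z _; rewrite !patchE !mem_setE !in_itv/= /U /I.
case: (ltP z y) => [zy|yz].
  by rewrite ?(ltW (lt_le_trans zy yh)) ?andbT ?mul1r addrC.
by rewrite andbF mul0r; case: ifP.
Qed.

(** Polar coordinates with the slope as angle: first z = y v at fixed y, then,
    at fixed v, the squared distance p = (1 + v^2) y^2 in place of y.  Both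
    changes of variable act on one variable, and the Jacobian
    1 / (2 (1 + v^2)) depends on v alone. *)
Lemma integral_triangle_slope :
  (\int[mu]_(y in `]0%R, h]) \int[mu]_(z in `]0%R, y]) I y z =
   \int[mu]_(v in `]0%R, 1%R])
      (((2 * (1 + v ^+ 2))^-1)%R%:E * mu (E `&` `]0%R, ((1 + v ^+ 2) * h ^+ 2)%R])))%E.
Proof.
pose J y v : \bar R := (`|y| * \1_E (y ^+ 2 + (y * v) ^+ 2))%:E.
have mJ : measurable_fun [set: R * R] (fun u => J u.1 u.2).
  by rewrite /J; measurability_tac.
transitivity (\int[mu]_(y in `]0%R, h]) \int[mu]_(v in `]0%R, 1%R]) J y v)%E.
  apply: eq_integral => y; rewrite mem_setE in_itv/= => /andP[y0 yh].
  pose B := [set z : R | E (y ^+ 2 + z ^+ 2)].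
  have mB : measurable B.
    rewrite -[B]setTI.
    have mf : measurable_fun [set: R] (fun z : R => y ^+ 2 + z ^+ 2).
      by measurability_tac.
    exact: mf.
  have IB z : I y z = (\1_B z)%:E.
    by rewrite /I !indicE; congr ((_ : bool)%:R%:E); apply/idP/idP; rewrite !inE.
  under eq_integral do rewrite IB.
  rewrite integral_indic//.
  have := @integral_indic_image R (fun v => y * v) (fun=> y) 0 1.
  rewrite mulr0 mulr1 => H; rewrite -[LHS]/(mu (B `&` `]0, y])) -H//.
  - by rewrite /J gtr0_norm.
  - by move=> v _; apply: is_derive_eq; rewrite /GRing.scale/=; ring.
  - by move=> v _; exact: cst_continuous.
  - by move=> v _; exact: ltW.
  - by move=> u v _ _; rewrite ler_pM2l.
have J0 y v : (0 <= J y v)%E by rewrite lee_fin mulr_ge0.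
rewrite (@tonelli_in _ _ _ _ _ mu mu)//.
apply: eq_integral => v _.
have v1 := oneDsqr_pos v.
have := @integral_indic_image R (fun y => (1 + v ^+ 2) * y ^+ 2)
  (fun y => 2 * (1 + v ^+ 2) * y) 0 h.
rewrite expr0n mulr0 => H; rewrite -H//.
- rewrite -ge0_integralZl_EFin//.
  + apply: eq_integral => y; rewrite mem_setE in_itv/= => /andP[y0 _].
    rewrite /J gtr0_norm// -EFinM mulrA.
    by congr ((_ * \1_E _)%:E); [field; lra|ring].
  + move=> y; rewrite /= in_itv/= => /andP[y0 _].
    by rewrite lee_fin !mulr_ge0// ltW.
  + by apply: measurable_funTS; measurability_tac.
  + by rewrite invr_ge0 ltW// mulr_gt0.
- exact: ltW.
- by move=> y _; apply: is_derive_eq; rewrite /GRing.scale/=; ring.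
- by move=> y _; exact: mulrl_continuous.
- by move=> y; rewrite in_itv/= => /andP[y0 _]; rewrite !mulr_ge0// ltW.
- move=> y z; rewrite !in_itv/= => /andP[y0 _] /andP[z0 _].
  by rewrite ler_pM2l// ler_sqr.
Qed.

End polar.

(** * The mass of the lattice domain, slice by slice *)

Section tonelli3.
Context {d1 d2 d3 : measure_display} {T1 : measurableType d1}
  {T2 : measurableType d2} {T3 : measurableType d3} {R : realType}.
Variables (m1 : {sigma_finite_measure set T1 -> \bar R})
  (m2 : {sigma_finite_measure set T2 -> \bar R})
  (m3 : {sigma_finite_measure set T3 -> \bar R}).
Variables (A : set T1) (B : set T2) (C : set T3) (f : T1 -> T2 -> T3 -> \bar R).
Hypotheses (mA : measurable A) (mB : measurable B) (mC : measurable C).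
Hypothesis f0 : forall x y z, (0 <= f x y z)%E.
Hypothesis mf : measurable_fun [set: T1 * T2 * T3]
  (fun u => f u.1.1 u.1.2 u.2).

Lemma tonelli3_in :
  (\int[m1]_(x in A) \int[m2]_(y in B) \int[m3]_(z in C) f x y z =
   \int[m2]_(y in B) \int[m3]_(z in C) \int[m1]_(x in A) f x y z)%E.
Proof.
rewrite (@tonelli_in _ _ _ _ _ m1 m2)//; last 2 first.
- by move=> x y _ _; exact: integral_ge0.
- exact: (@measurable_integral_in _ _ _ _ _ m3 setT C
    (fun u z => f u.1 u.2 z)).
apply: eq_integral => y _; rewrite (@tonelli_in _ _ _ _ _ m1 m3)//.
have mp : measurable_fun [set: T1 * T3] (fun u : T1 * T3 => ((u.1, y), u.2)).
  by do 2 ?apply: measurable_fun_pair.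
exact: (measurableT_comp mf mp).
Qed.
End tonelli3.

Section slices.
Context {R : realType}.
Local Notation mu := (@lebesgue_measure R).
Implicit Types (A : set R) (t x y v : R).

Lemma xiE t y1 y2 : 0 < t ->
  xi t y1 y2 = Num.sqrt ((y1 ^+ 2 + y2 ^+ 2) / (y1 ^+ 2 + y2 ^+ 2 + 1 / t ^+ 2)).
Proof.
move=> t0; have w0 : 0 < y1 ^+ 2 + y2 ^+ 2 + 1 / t ^+ 2.
  by rewrite ltr_wpDl ?addr_ge0 ?sqr_ge0// divr_gt0// exprn_gt0.
rewrite /xi /xiR /xiI !expr_div_n sqr_sqrtr ?(ltW w0)//.
by rewrite -mulrDl.
Qed.

Lemma measurable_xi : measurable_fun [set: R * R * R]
  (fun u => xi u.1.1 u.1.2 u.2).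
Proof. by rewrite /xi /xiR /xiI; measurability_tac. Qed.

Lemma measurable_lattice_domain : measurable (@lattice_domain R).
Proof.
pose b (u : R * R * R) := [&& 0 < u.1.1, u.1.1 ^+ 2 <= u.1.2 ^+ 2 + u.2 ^+ 2 + 1 / u.1.1 ^+ 2,
  2 * `|u.1.2| <= u.1.1 & 2 * `|u.2| <= u.1.1].
have mb : measurable_fun [set: R * R * R] b.
  by rewrite /b; measurability_tac.
have -> : @lattice_domain R = b @^-1` [set true].
  by apply/seteqP; split => u /=; rewrite /lattice_domain /b /=;
    [move=> [-> -> -> ->]|move/and4P].
by rewrite -[X in measurable X]setTI; exact: mb.
Qed.

(** For fixed t, the values of p = y1 ^+ 2 + y2 ^+ 2 that satisfy the reduction
    condition t ^+ 2 <= |beta| ^+ 2 and for which xi lies in A.  The conditions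
    on y1 and y2 separately, which make a square, are treated apart. *)
Definition slice A t : set R :=
  [set p | t ^+ 2 <= p + 1 / t ^+ 2 /\ A (Num.sqrt (p / (p + 1 / t ^+ 2)))].

Lemma measurable_slice A t : measurable A -> measurable (slice A t).
Proof.
move=> mA; have -> : slice A t = [set p | t ^+ 2 <= p + 1 / t ^+ 2] `&`
   (fun p => Num.sqrt (p / (p + 1 / t ^+ 2))) @^-1` A by [].
apply: measurableI.
- pose b (p : R) := t ^+ 2 <= p + 1 / t ^+ 2.
  have mb : measurable_fun [set: R] b by rewrite /b; measurability_tac.
  by rewrite -[X in measurable X]setTI; exact: mb.
- have mf : measurable_fun [set: R] (fun p => Num.sqrt (p / (p + 1 / t ^+ 2))).
    by measurability_tac.
  by rewrite -[X in measurable X]setTI; exact: mf.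
Qed.

(** The factor 8 counts four quadrants, with two triangles in each. *)
Lemma integral_slice A t : measurable A -> 0 < t ->
  (\int[mu]_y1 \int[mu]_y2
    (t * (\1_(@lattice_domain R) (t, y1, y2) * \1_A (xi t y1 y2)))%:E =
  (8 * t)%:E * \int[mu]_(v in `]0%R, 1%R])
    (((2 * (1 + v ^+ 2))^-1)%R%:E * mu (slice A t `&` `]0%R, ((1 + v ^+ 2) * (t / 2) ^+ 2)%R])))%E.
Proof.
move=> mA t0.
have mE := measurable_slice _ t mA; set E := slice A t.
pose J y z : \bar R :=
  (((`|y| <= t / 2) && (`|z| <= t / 2))%:R * \1_E (y ^+ 2 + z ^+ 2))%:E.
have J0 y z : (0 <= J y z)%E by rewrite lee_fin mulr_ge0// ler0n.
have mJ : measurable_fun [set: R * R] (fun u => J u.1 u.2).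
  by rewrite /J; measurability_tac.
have mJ1 y : measurable_fun [set: R] (J y) by rewrite /J; measurability_tac.
transitivity (\int[mu]_y \int[mu]_z (t%:E * J y z))%E.
  apply: eq_integral => y _; apply: eq_integral => z _.
  rewrite -EFinM; congr (_ * _)%:E.
  rewrite !indicE -!natrM !mulnb; congr ((_ : bool)%:R).
  rewrite xiE//; apply/idP/idP.
  - move=> /andP[]; rewrite !inE => -[_ tD yt zt] AE.
    rewrite !ler_pdivlMr ?ltr0n// !(mulrC _ 2) yt zt/=.
    by rewrite inE; split.
  - move=> /andP[/andP[yt zt]]; rewrite !inE => -[tD AE].
    apply/andP; split; last exact/mem_set.
    apply/mem_set; split => //=.
    + by move: yt; rewrite ler_pdivlMr ?ltr0n// mulrC.
    + by move: zt; rewrite ler_pdivlMr ?ltr0n// mulrC.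
transitivity (t%:E * \int[mu]_y \int[mu]_z J y z)%E.
  rewrite -ge0_integralZl_EFin ?ltW//; last 2 first.
  - by move=> y _; exact: integral_ge0.
  - exact: (@measurable_integral_in _ _ _ _ _ mu setT setT J).
  apply: eq_integral => y _; rewrite -ge0_integralZl_EFin ?ltW//.
  exact: mJ1.
rewrite /J (@integral_square_quarter _ E (t / 2))// ?divr_gt0//.
rewrite (@integral_quarter_triangle _ E (t / 2))// ?divr_gt0//.
rewrite (@integral_triangle_slope _ E (t / 2))// ?divr_gt0//.
rewrite !muleA -!EFinM; congr (_%:E * _)%E; ring.
Qed.

(** The law of xi, up to the normalising constant of the density of
    (t, y1, y2). *)
Definition lattice_mass A : \bar R :=
  (\int[mu]_t \int[mu]_y1 \int[mu]_y2
    (t * (\1_(@lattice_domain R) (t, y1, y2) * \1_A (xi t y1 y2)))%:E)%E.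

(** The variable t is moved to the innermost place, because the integrals in t
    are elementary whereas those in the slope are not.  The parameter x is left
    free: it will be xi itself for general A, and p / t ^+ 2 for the total
    mass.  The absolute value of t makes the integrand non-negative on the
    whole space. *)
Lemma lattice_mass_swap A (phi : R -> R -> R -> R) : measurable A ->
  (forall t v x, 0 <= phi t v x) ->
  measurable_fun [set: R * R * R] (fun u => phi u.1.1 u.1.2 u.2) ->
  (forall t v, (0 < t)%R -> (0 < v <= 1)%R ->
    mu (slice A t `&` `]0%R, ((1 + v ^+ 2) * (t / 2) ^+ 2)%R]) =
    \int[mu]_(x in `]0%R, 1%R[) (phi t v x)%:E)%E ->
  (lattice_mass A = \int[mu]_(v in `]0%R, 1%R]) \int[mu]_(x in `]0%R, 1%R[)
    \int[mu]_(t in `]0%R, +oo[) (4 * `|t| / (1 + v ^+ 2) * phi t v x)%:E)%E.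
Proof.
move=> mA phi0 mphi sliceE.
pose f t v x : \bar R := (4 * `|t| / (1 + v ^+ 2) * phi t v x)%:E.
have f0 t v x : (0 <= f t v x)%E.
  rewrite lee_fin mulr_ge0// divr_ge0 ?mulr_ge0//.
  by rewrite addr_ge0// sqr_ge0.
have mf : measurable_fun [set: R * R * R] (fun u => f u.1.1 u.1.2 u.2).
  apply/measurable_EFinP; apply: measurable_funM => //.
  by measurability_tac.
transitivity (\int[mu]_(t in `]0%R, +oo[) \int[mu]_(v in `]0%R, 1%R])
    \int[mu]_(x in `]0%R, 1%R[) f t v x)%E; last exact: tonelli3_in.
rewrite /lattice_mass [RHS]integral_mkcond; apply: eq_integral => t _.
rewrite patchE mem_setE in_itv/= andbT; case: ltP => [t0|t0]; last first.
  apply: integral0_eq => y _; apply: integral0_eq => z _.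
  rewrite (_ : \1__ (t, y, z) = 0) ?mul0r ?mulr0//.
  by rewrite indicE memNset// => -[/=]; rewrite ltNge t0.
have v1 := @oneDsqr_pos R.
pose g v x : \bar R := ((2 * (1 + v ^+ 2))^-1 * phi t v x)%:E.
have g0 v x : (0 <= g v x)%E.
  by rewrite lee_fin mulr_ge0// invr_ge0 mulr_ge0// ltW.
have mphit : measurable_fun [set: R * R] (fun u => phi t u.1 u.2).
  have mp : measurable_fun [set: R * R] (fun u : R * R => ((t, u.1), u.2)).
    by do 2 ?apply: measurable_fun_pair.
  exact: (measurableT_comp mphi mp).
have mphitv v : measurable_fun [set: R] (phi t v).
  exact: (measurableT_comp mphit (pair1_measurable v)).
have mg : measurable_fun [set: R * R] (fun u => g u.1 u.2).
  by apply/measurable_EFinP; apply: measurable_funM => //; measurability_tac.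
transitivity ((8 * t)%:E *
    \int[mu]_(v in `]0%R, 1%R]) \int[mu]_(x in `]0%R, 1%R[) g v x)%E.
  rewrite (integral_slice _ _ mA t0); congr (_ * _)%E.
  apply: eq_integral => v; rewrite mem_setE in_itv/= => v01.
  rewrite sliceE// -ge0_integralZl_EFin//.
  - by move=> x _; rewrite lee_fin.
  - by apply/measurable_EFinP/measurable_funTS; exact: mphitv.
  - by rewrite invr_ge0 mulr_ge0// ltW.
have t80 : 0 <= 8 * t by rewrite mulr_ge0// ltW.
rewrite -ge0_integralZl_EFin//; last 2 first.
- by move=> v _; exact: integral_ge0.
- exact: measurable_integral_in.
apply: eq_integral => v _; rewrite -ge0_integralZl_EFin//; last first.
  apply: measurable_funTS; apply: (measurableT_comp mg (pair1_measurable v)).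
apply: eq_integral => x _; rewrite /f /g -EFinM gtr0_norm//.
by congr (_%:E); have := v1 v; move=> ?; field; lra.
Qed.

End slices.

(** * Integrals over ranges of the fourth power of t *)

Section fourth_root.
Context {R : realType}.
Local Notation mu := (@lebesgue_measure R).

Definition root4 (z : R) := Num.sqrt (Num.sqrt z).

Lemma root4K z : 0 <= z -> root4 z ^+ 4 = z.
Proof.
by move=> z0; rewrite -[4%N]/(2 * 2)%N exprM !sqr_sqrtr ?sqrtr_ge0.
Qed.

Lemma root4_gt0 z : 0 < z -> 0 < root4 z.
Proof. by move=> z0; rewrite !sqrtr_gt0. Qed.

Lemma le_root4 t z : 0 <= t -> 0 <= z -> (t <= root4 z) = (t ^+ 4 <= z).
Proof.
by move=> t0 z0; rewrite -[in RHS](root4K _ z0) ler_pXn2r// nnegrE sqrtr_ge0.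
Qed.

Lemma root4_le t z : 0 <= t -> 0 <= z -> (root4 z <= t) = (z <= t ^+ 4).
Proof.
by move=> t0 z0; rewrite -[in RHS](root4K _ z0) ler_pXn2r// nnegrE sqrtr_ge0.
Qed.

Lemma ln_root4 z : 0 < z -> ln (root4 z) = ln z / 4.
Proof.
move=> z0; rewrite -[in RHS](root4K _ (ltW z0)) lnXn ?root4_gt0//.
by rewrite -mulr_natr; field.
Qed.

(** The maximum with 0 covers an empty range of t. *)
Lemma integral_inv_fourth (a b : R) : 0 < a -> 0 < b ->
  (\int[mu]_(t in `]0%R, +oo[) (t^-1 * ((a <= t ^+ 4) && (t ^+ 4 <= b))%:R)%:E =
   (Num.max 0 (ln b - ln a) / 4)%:E)%E.
Proof.
move=> a0 b0; have [a0' b0'] := (ltW a0, ltW b0).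
transitivity (\int[mu]_(t in `[root4 a, root4 b]) (t^-1)%:E)%E.
  rewrite [LHS]integral_mkcond [RHS]integral_mkcond; apply: eq_integral => t _.
  rewrite !patchE !mem_setE !in_itv/= andbT; case: ltP => [t0|t0].
    have t0' := ltW t0; rewrite root4_le ?le_root4//.
    by case: (_ && _); rewrite ?mulr1 ?mulr0.
  by rewrite (lt_geF (le_lt_trans t0 (root4_gt0 _ a0))).
have [ab|ba] := leP a b; last first.
  rewrite set_itv_ge ?integral_set0.
    by rewrite max_l ?mul0r// subr_le0 ler_ln ?posrE// ltW.
  rewrite bnd_simp -ltNge ltNge le_root4 ?sqrtr_ge0//.
  by rewrite root4K// -ltNge.
rewrite (@integral_itv_bnd_ftc _ (@ln R)).
- rewrite !ln_root4// max_r ?subr_ge0 ?ler_ln//.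
  by congr (_%:E); ring.
- by rewrite le_root4 ?sqrtr_ge0// root4K.
- move=> t; rewrite in_itv/= => /andP[at_ _]; apply: is_derive1_ln.
  by rewrite (lt_le_trans _ at_)// root4_gt0.
- move=> t; rewrite in_itv/= => /andP[at_ _]; apply: inv_continuous.
  by rewrite gt_eqF// (lt_le_trans _ at_)// root4_gt0.
Qed.

Lemma integral_cube_fourth (b : R) : 0 < b ->
  (\int[mu]_(t in `]0%R, +oo[) (t ^+ 3 * (t ^+ 4 <= b)%R%:R)%:E =
   (b / 4)%:E)%E.
Proof.
move=> b0; have b0' := ltW b0.
transitivity (\int[mu]_(t in `]0%R, root4 b]) (t ^+ 3)%:E)%E.
  rewrite [LHS]integral_mkcond [RHS]integral_mkcond; apply: eq_integral => t _.
  rewrite !patchE !mem_setE !in_itv/= andbT; case: ltP => //= t0.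
  have t0' := ltW t0; rewrite le_root4//.
  by case: (_ <= b); rewrite ?mulr1 ?mulr0.
rewrite (@integral_itv_bnd_ftc _ (fun t => t ^+ 4 / 4)).
- by rewrite root4K// expr0n mul0r subr0.
- by rewrite ltW// root4_gt0.
- by move=> t _; apply: is_derive_eq; rewrite /GRing.scale/=; field.
- by move=> t _; exact: exprn_continuous.
Qed.

End fourth_root.

(** * The slices in the coordinate xi *)

Section mass.
Context {R : realType}.
Local Notation mu := (@lebesgue_measure R).
Implicit Types (A : set R) (t x v : R).

(** With q = p / t ^+ 2, the condition t ^+ 2 <= p + 1 / t ^+ 2 reads
    t ^+ 4 * (1 - q) <= 1. *)
Lemma slice_total t v : 0 < t -> 0 < v <= 1 ->
  (mu (slice [set: R] t `&` `]0%R, ((1 + v ^+ 2) * (t / 2) ^+ 2)%R]) =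
  \int[mu]_(q in `]0%R, 1%R[)
    (t ^+ 2 * ((q <= (1 + v ^+ 2) / 4) && (t ^+ 4 * (1 - q) <= 1))%R%:R)%:E)%E.
Proof.
move=> t0 /andP[v0 v1].
have v2 : v ^+ 2 <= 1 by rewrite expr_le1// ltW.
have k0 : 0 <= (1 + v ^+ 2) / 4 by rewrite divr_ge0// addr_ge0// sqr_ge0.
have k1 : (1 + v ^+ 2) / 4 < 1 by lra.
have := @integral_indic_image R (fun q => t ^+ 2 * q) (fun=> t ^+ 2)
  0 ((1 + v ^+ 2) / 4).
rewrite mulr0 (_ : t ^+ 2 * _ = (1 + v ^+ 2) * (t / 2) ^+ 2); last by field.
move=> <-//.
- rewrite [LHS]integral_mkcond [RHS]integral_mkcond; apply: eq_integral => q _.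
  rewrite !patchE !mem_setE !in_itv/=; case: ltP => //= q0.
  have [qk|kq] := leP q _; last by rewrite mulr0; case: ifP.
  rewrite (le_lt_trans qk k1)/= indicE; congr ((_ * (_ : bool)%:R)%:E).
  have -> : (t ^+ 4 * (1 - q) <= 1) = (t ^+ 2 <= t ^+ 2 * q + 1 / t ^+ 2).
    rewrite -lerBlDl -[in RHS](ler_pM2r (exprn_gt0 2 t0)).
    rewrite divfK ?gt_eqF ?exprn_gt0//; congr (_ <= _); ring.
  by apply/idP/idP; rewrite inE; [case|].
- by move=> q _; apply: is_derive_eq; rewrite /GRing.scale/=; ring.
- by move=> q _; exact: cst_continuous.
- by move=> q _; exact: sqr_ge0.
- by move=> p q _ _; rewrite ler_pM2l// exprn_gt0.
- exact: measurable_slice.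
Qed.

(** The new variable is x = xi, so that p = x ^+ 2 / (t ^+ 2 * (1 - x ^+ 2)), an
    increasing function whose derivative is the first factor of the integrand.
    Moreover p + 1 / t ^+ 2 = (t ^+ 2 * (1 - x ^+ 2))^-1, which turns the
    reduction condition into an upper bound for t ^+ 4; the bound
    p <= (1 + v ^+ 2) * (t / 2) ^+ 2 becomes a lower bound. *)
Lemma slice_general A t v : measurable A -> 0 < t -> 0 < v <= 1 ->
  (mu (slice A t `&` `]0%R, ((1 + v ^+ 2) * (t / 2) ^+ 2)%R]) =
  \int[mu]_(x in `]0%R, 1%R[)
    (2 * `|x| / (t ^+ 2 * (1 - x ^+ 2) ^+ 2) *
      (\1_A x * ((x ^+ 2 / (1 - x ^+ 2) <= (1 + v ^+ 2) / 4 * t ^+ 4) &&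
         (t ^+ 4 <= (1 - x ^+ 2)^-1))%R%:R))%:E)%E.
Proof.
move=> mA t0 /andP[v0 v1].
have v2 : 0 <= v ^+ 2 <= 1 by rewrite sqr_ge0 expr_le1// ltW.
have t2 : 0 < t ^+ 2 by rewrite exprn_gt0.
have t4 : 0 < t ^+ 4 by rewrite exprn_gt0.
set k := (1 + v ^+ 2) / 4.
have k0 : 0 < k by rewrite /k; lra.
(* b is the value of x at the end point p = k * t ^+ 2 *)
pose w := k * t ^+ 4 / (1 + k * t ^+ 4); pose b := Num.sqrt w.
have kt0 : 0 < k * t ^+ 4 by rewrite mulr_gt0.
have w0 : 0 < w by rewrite divr_gt0// ltr_wpDl.
have w1 : w < 1 by rewrite ltr_pdivrMr ?mul1r ?ltrDr// ltr_wpDl.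
have b0 : 0 < b by rewrite sqrtr_gt0.
have b2 : b ^+ 2 = w by rewrite sqr_sqrtr// ltW.
have b1 : b < 1 by rewrite -(ltr_pXn2r (_ : 0 < 2)%N) ?nnegrE ?expr1n ?b2// ltW.
have x1 x : x \in `[0, b] -> 0 < 1 - x ^+ 2.
  rewrite in_itv/= => /andP[x0 xb]; rewrite subr_gt0.
  by rewrite expr_lt1// (le_lt_trans xb).
pose F x := x ^+ 2 / (t ^+ 2 * (1 - x ^+ 2)).
have := @integral_indic_image R F
  (fun x => 2 * x / (t ^+ 2 * (1 - x ^+ 2) ^+ 2)) 0 b.
have -> : F 0 = 0 by rewrite /F expr0n mul0r.
have -> : F b = (1 + v ^+ 2) * (t / 2) ^+ 2.
  rewrite /F b2 /w; have : 1 + k * t ^+ 4 != 0 by rewrite gt_eqF// ltr_wpDl.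
  have := kt0; rewrite /k => kt1 ?; field; apply/and3P; split; [lra|lra|].
  by rewrite gt_eqF.
move=> <-//.
- rewrite [LHS]integral_mkcond [RHS]integral_mkcond; apply: eq_integral => x _.
  rewrite !patchE !mem_setE !in_itv/=; case: ltP => //= x0.
  have [x11|x11] := ltP x 1; last by rewrite leNgt (lt_le_trans b1).
  have x2 : 0 < 1 - x ^+ 2 by rewrite subr_gt0 expr_lt1// ltW.
  have -> : (x ^+ 2 / (1 - x ^+ 2) <= k * t ^+ 4) = (x <= b).
    have x0' := ltW x0; have := ltW kt0 => kt0'.
    rewrite -(@ler_pXn2r _ 2 isT x b) ?nnegrE ?sqrtr_ge0// b2 /w.
    rewrite ler_pdivrMr// ler_pdivlMr ?ltr_wpDr//.
    by apply/idP/idP => ?; lra.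
  case: (x <= b); last by rewrite /= mulr0 mulr0.
  rewrite gtr0_norm//; congr ((_ * _)%:E).
  have Fw : F x + 1 / t ^+ 2 = (t ^+ 2 * (1 - x ^+ 2))^-1.
    by rewrite /F; field; rewrite ?gt_eqF.
  have -> : \1_(slice A t) (F x) = \1_A x * (t ^+ 4 <= (1 - x ^+ 2)^-1)%R%:R :> R.
    rewrite !indicE -natrM mulnb; congr ((_ : bool)%:R).
    have -> : (t ^+ 4 <= (1 - x ^+ 2)^-1) = (t ^+ 2 <= F x + 1 / t ^+ 2).
      rewrite Fw invfM mulrC ler_pdivlMr// -exprD//.
    have -> : (x \in A) = (Num.sqrt (F x / (F x + 1 / t ^+ 2)) \in A).
      rewrite Fw invrK (_ : _ * _ = x ^+ 2) ?sqrtr_sqr ?gtr0_norm//.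
      by rewrite /F; field; rewrite ?gt_eqF.
    by rewrite /slice; apply/idP/andP; rewrite !inE; [case|move=> []].
  by rewrite mulrC.
- exact: ltW.
- move=> x /x1 x10.
  have D1 : is_derive x 1 (fun x : R => t ^+ 2 * (1 - x ^+ 2)) (- (2 * t ^+ 2 * x)).
    by apply: is_derive_eq; rewrite /GRing.scale/=; ring.
  have /(is_derive1V D1) D2 : t ^+ 2 * (1 - x ^+ 2) != 0.
    by rewrite mulf_neq0 ?gt_eqF.
  have D3 : is_derive x 1 (fun x : R => x ^+ 2) (2 * x).
    by apply: is_derive_eq; rewrite /GRing.scale/=; ring.
  apply: (is_derive1_cast (is_deriveM D3 D2)).
  by rewrite /GRing.scale/=; field; rewrite ?gt_eqF.
- move=> x /x1 x10; rewrite /prop_for /continuous_at; continuity_tac.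
  by rewrite mulf_neq0 ?gt_eqF ?exprn_gt0.
- move=> x xb; have x10 := x1 _ xb; rewrite divr_ge0//.
  + by rewrite mulr_ge0// (itvP xb).
  + by rewrite mulr_ge0 ?sqr_ge0.
- move=> x y xb yb; have x10 := x1 _ xb; have y10 := x1 _ yb.
  have Fi z : 0 < 1 - z ^+ 2 -> F z = (t ^+ 2)^-1 * ((1 - z ^+ 2)^-1 - 1).
    by move=> z10; rewrite /F; field; rewrite ?gt_eqF.
  rewrite !Fi// ler_pM2l ?invr_gt0// lerD2r lef_pV2 ?posrE//.
  rewrite lerD2l lerN2 ler_pXn2r// nnegrE; rewrite ?(itvP xb) ?(itvP yb)//.
- exact: measurable_slice.
Qed.

End mass.

(** * The mass as an integral of logarithms *)

Section mass_formulas.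
Context {R : realType}.
Local Notation mu := (@lebesgue_measure R).
Implicit Types (A : set R) (t x v : R).

(** Integrating 4 * t ^+ 3 up to t ^+ 4 = (1 - q)^-1 leaves (1 - q)^-1, whose
    integral up to q = (1 + v ^+ 2) / 4 is the logarithm. *)
Lemma lattice_massT : (lattice_mass [set: R] =
  \int[mu]_(v in `]0%R, 1%R]) (ln (4 / (3 - v ^+ 2)) / (1 + v ^+ 2))%:E)%E.
Proof.
pose phi t v q := t ^+ 2 * ((q <= (1 + v ^+ 2) / 4) && (t ^+ 4 * (1 - q) <= 1))%R%:R.
rewrite (@lattice_mass_swap _ [set: R] phi)//; first last.
- by move=> t v t0 v01; exact: slice_total.
- by rewrite /phi; measurability_tac.
- by move=> t v q; rewrite mulr_ge0 ?sqr_ge0.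
apply: eq_integral => v; rewrite mem_setE in_itv/= => /andP[v0 v1].
have v2 : v ^+ 2 <= 1 by rewrite expr_le1// ltW.
have v20 := oneDsqr_pos v.
set k := (1 + v ^+ 2) / 4.
have k0 : 0 < k by rewrite divr_gt0.
have k1 : k < 1 by rewrite /k; lra.
transitivity (\int[mu]_(q in `]0%R, k]) ((1 + v ^+ 2)^-1 / (1 - q))%:E)%E.
  rewrite [LHS]integral_mkcond [RHS]integral_mkcond; apply: eq_integral => q _.
  rewrite !patchE !mem_setE !in_itv/=; case: ltP => //= q0.
  have [q1|q1] := ltP q 1; last by rewrite leNgt (lt_le_trans k1).
  have q10 : 0 < 1 - q by rewrite subr_gt0.
  rewrite /phi -/k; case: (leP q k) => qk; last first.
    by apply: integral0_eq => t _; rewrite !mulr0.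
  transitivity (\int[mu]_(t in `]0%R, +oo[) ((4 / (1 + v ^+ 2))%:E *
      (t ^+ 3 * (t ^+ 4 <= (1 - q)^-1)%R%:R)%:E))%E.
    apply: eq_integral => t; rewrite mem_setE in_itv/= andbT => t0.
    rewrite -EFinM gtr0_norm// -[(1 - q)^-1]div1r ler_pdivlMr//.
    by congr (_%:E); rewrite exprS; ring.
  rewrite ge0_integralZl_EFin//.
  - rewrite integral_cube_fourth ?invr_gt0// -EFinM; congr (_%:E).
    by field; rewrite !gt_eqF.
  - move=> t; rewrite /= in_itv/= andbT => t0.
    by rewrite lee_fin mulr_ge0// exprn_ge0// ltW.
  - by apply: measurable_funTS; measurability_tac.
  - by rewrite divr_ge0// ltW.
rewrite (@integral_itv_bnd_ftc _ (fun q => - (1 + v ^+ 2)^-1 * ln (1 - q))).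
- rewrite subr0 ln1 mulr0 subr0; congr (_%:E).
  have -> : 4 / (3 - v ^+ 2) = (1 - k)^-1 by rewrite /k; field; lra.
  by rewrite lnV ?posrE ?subr_gt0//; ring.
- exact: ltW.
- move=> q; rewrite in_itv/= => /andP[q0 qk].
  have D1 : is_derive q 1 (fun q : R => 1 - q) (- 1).
    by apply: is_derive_eq; rewrite /GRing.scale/=; ring.
  have q1 : 0 < 1 - q by rewrite subr_gt0 (le_lt_trans qk).
  apply: (is_derive1_cast (is_deriveZ (- (1 + v ^+ 2)^-1) (is_derive1_ln_comp D1 q1))).
  by rewrite /GRing.scale/=; field; rewrite !gt_eqF.
- move=> q; rewrite in_itv/= => /andP[q0 qk].
  rewrite /prop_for /continuous_at; continuity_tac.
  by rewrite gt_eqF// subr_gt0 (le_lt_trans qk).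
Qed.

(** With v = tan theta, the integral over ]0, pi/4] of the positive part of
    - ln (4 x^2 cos^2 theta). *)
Definition logslope x : \bar R :=
  (\int[mu]_(v in `]0%R, 1%R])
    (Num.max 0 (ln ((1 + v ^+ 2) / (4 * x ^+ 2))) / (1 + v ^+ 2))%:E)%E.

(** After substitution the integrand is proportional to t^-1 on a range of
    t ^+ 4 whose end points have the ratio (1 + v ^+ 2) / (4 * x ^+ 2). *)
Lemma lattice_massE A : measurable A -> (lattice_mass A =
  \int[mu]_(x in `]0%R, 1%R[)
    ((2 * x / (1 - x ^+ 2) ^+ 2 * \1_A x)%:E * logslope x))%E.
Proof.
move=> mA.
pose phi t v x := 2 * `|x| / (t ^+ 2 * (1 - x ^+ 2) ^+ 2) *
  (\1_A x * ((x ^+ 2 / (1 - x ^+ 2) <= (1 + v ^+ 2) / 4 * t ^+ 4) &&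
         (t ^+ 4 <= (1 - x ^+ 2)^-1))%R%:R).
rewrite (@lattice_mass_swap _ A phi)//; first last.
- by move=> t v t0 v01; exact: slice_general.
- by rewrite /phi; measurability_tac.
- move=> t v q; apply: mulr_ge0; last by rewrite mulr_ge0.
  apply: divr_ge0; first by rewrite mulr_ge0.
  by apply: mulr_ge0; exact: sqr_ge0.
pose f v x : \bar R := (2 * `|x| / (1 - x ^+ 2) ^+ 2 * \1_A x *
  (Num.max 0 (ln ((1 + v ^+ 2) / (4 * x ^+ 2))) / (1 + v ^+ 2)))%:E.
have max_ge0 (r : R) : 0 <= Num.max 0 r by rewrite le_max lexx.
have f0 v x : (0 <= f v x)%E.
  rewrite lee_fin; apply: mulr_ge0; last by rewrite divr_ge0// ltW.
  by rewrite mulr_ge0// divr_ge0 ?sqr_ge0// mulr_ge0.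
have mlog : measurable_fun [set: R * R] (fun u : R * R =>
    Num.max 0 (ln ((1 + u.1 ^+ 2) / (4 * u.2 ^+ 2))) / (1 + u.1 ^+ 2)).
  by apply: measurable_funM; [apply: measurable_maxr|]; measurability_tac.
have mf : measurable_fun [set: R * R] (fun u => f u.1 u.2).
  apply/measurable_EFinP; apply: measurable_funM => //.
  by measurability_tac.
transitivity (\int[mu]_(v in `]0%R, 1%R]) \int[mu]_(x in `]0%R, 1%R[) f v x)%E.
  apply: eq_integral => v; rewrite mem_setE in_itv/= => /andP[v0 v1].
  have v20 := oneDsqr_pos v.
  apply: eq_integral => x; rewrite mem_setE in_itv/= => /andP[x0 x1].
  have x2 : 0 < 1 - x ^+ 2 by rewrite subr_gt0 expr_lt1// ltW.
  transitivity (\int[mu]_(t in `]0%R, +oo[)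
    ((8 * x / (1 - x ^+ 2) ^+ 2 * \1_A x / (1 + v ^+ 2))%:E *
      (t^-1 * ((x ^+ 2 / (1 - x ^+ 2) / ((1 + v ^+ 2) / 4) <= t ^+ 4) &&
         (t ^+ 4 <= (1 - x ^+ 2)^-1))%R%:R)%:E))%E.
    apply: eq_integral => t; rewrite mem_setE in_itv/= andbT => t0.
    rewrite -EFinM /phi !gtr0_norm// [in RHS]ler_pdivrMr ?divr_gt0//.
    rewrite [t ^+ 4 * _]mulrC; congr (_%:E).
    by field; rewrite !gt_eqF.
  have a0 : 0 < x ^+ 2 / (1 - x ^+ 2) / ((1 + v ^+ 2) / 4).
    by rewrite !divr_gt0// exprn_gt0.
  rewrite ge0_integralZl_EFin//.
  - rewrite integral_inv_fourth ?invr_gt0// -EFinM /f gtr0_norm//; congr (_%:E).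
    rewrite -ln_div ?posrE ?invr_gt0//.
    have -> : (1 - x ^+ 2)^-1 / (x ^+ 2 / (1 - x ^+ 2) / ((1 + v ^+ 2) / 4)) =
       (1 + v ^+ 2) / (4 * x ^+ 2) by field; rewrite !gt_eqF.
    by field; rewrite !gt_eqF.
  - move=> t; rewrite /= in_itv/= andbT => t0.
    by rewrite lee_fin mulr_ge0// invr_ge0 ltW.
  - by apply: measurable_funTS; measurability_tac.
  - apply: divr_ge0; last exact: ltW.
    by rewrite mulr_ge0// divr_ge0 ?sqr_ge0// mulr_ge0// ltW.
rewrite (@tonelli_in _ _ _ _ _ mu mu)//.
apply: eq_integral => x; rewrite mem_setE in_itv/= => /andP[x0 x1].
rewrite -ge0_integralZl_EFin//.
- by apply: eq_integral => v _; rewrite /f gtr0_norm// EFinM.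
- by move=> v _; rewrite lee_fin divr_ge0// ltW.
- by apply/measurable_EFinP/measurable_funTS; exact: (measurableT_comp mlog (pair2_measurable x)).
- by rewrite mulr_ge0// divr_ge0 ?sqr_ge0// mulr_ge0// ltW.
Qed.

Lemma measurable_logslope : measurable_fun [set: R] logslope.
Proof.
have mlog : measurable_fun [set: R * R] (fun u : R * R =>
    Num.max 0 (ln ((1 + u.2 ^+ 2) / (4 * u.1 ^+ 2))) / (1 + u.2 ^+ 2)).
  by apply: measurable_funM; [apply: measurable_maxr|]; measurability_tac.
apply: (@measurable_integral_in _ _ _ _ _ mu setT `]0%R, 1%R]
  (fun x v => (Num.max 0 (ln ((1 + v ^+ 2) / (4 * x ^+ 2))) / (1 + v ^+ 2))%:E)) => //.
- by move=> x v _ _; rewrite lee_fin divr_ge0 ?le_max ?lexx// ltW.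
- exact/measurable_EFinP.
Qed.

Lemma logslope_ge0 x : (0 <= logslope x)%E.
Proof.
apply: integral_ge0 => v _; rewrite lee_fin divr_ge0 ?le_max ?lexx//.
exact: ltW.
Qed.

End mass_formulas.

(** * Primitives *)

Section mean_value.
Context {R : realType}.
Implicit Types (F f : R -> R) (a b : R).

Lemma is_derive_mvt F f a b : a <= b ->
  (forall x, a <= x <= b -> is_derive x 1 F (f x)) ->
  exists2 c, a <= c <= b & F b - F a = f c * (b - a).
Proof.
move=> ab dF.
have dF' x : x \in `]a, b[ -> is_derive x 1 F (f x).
  by rewrite in_itv/= => /andP[ax xb]; apply: dF; rewrite !ltW.
have cF : {within `[a, b], continuous F}.
  apply: within_continuous_pt; apply: (@derive_pt_continuous _ F f) => x.
  by rewrite in_itv/=; exact: dF.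
by have [c] := MVT_segment ab dF' cF; rewrite in_itv; exists c.
Qed.

Lemma is_derive_le F f a b : a <= b ->
  (forall x, a <= x <= b -> is_derive x 1 F (f x)) ->
  (forall x, a <= x <= b -> 0 <= f x) -> F a <= F b.
Proof.
move=> ab dF f0; have [c cab FE] := is_derive_mvt _ _ _ _ ab dF.
by rewrite -subr_ge0 FE mulr_ge0 ?subr_ge0// f0.
Qed.

Lemma is_derive0_eq F a b x y : (forall z, a < z < b -> is_derive z 1 F 0) ->
  a < x < b -> a < y < b -> F x = F y.
Proof.
move=> dF; wlog xy : x y / x <= y.
  by move=> H xab yab; case: (leP x y) => [|/ltW] xy; [|symmetry]; exact: H.
move=> /andP[ax _] /andP[_ yb].
have [|c _ /eqP] := is_derive_mvt F (fun=> 0) _ _ xy.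
  move=> z /andP[xz zy].
  by apply: dF; rewrite (lt_le_trans ax)// (le_lt_trans zy).
by rewrite mul0r subr_eq0 => /eqP.
Qed.

End mean_value.

Section primitive.
Context {R : realType}.
Local Notation mu := (@lebesgue_measure R).
Variables (f : R -> R) (b : R).
Hypothesis cf : forall x, - b < x < b -> {for x, continuous f}.

(** Near x, the primitive differs by a constant from an integral with a fixed
    lower end point -m, to which the fundamental theorem of calculus applies. *)
Lemma primitive_exists : exists K : R -> R,
  K 0 = 0 /\ forall x, - b < x < b -> is_derive x 1 K (f x).
Proof.
pose K x := if 0 <= x then \int[mu]_(t in `]0, x]) f t
            else - \int[mu]_(t in `]x, 0]) f t.
exists K; split.
  by rewrite /K lexx set_itv_ge ?bnd_simp// Rintegral_set0.
move=> x /andP[bx xb].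
have [m [m0 mb /andP[mx xm]]] : exists m, [/\ 0 < m, m < b & - m < x < m].
  pose m := (`|x| + b) / 2; exists m.
  have nx : `|x| < b by rewrite ltr_norml bx.
  rewrite /m; split; [have := normr_ge0 x; lra|lra|].
  by rewrite -ltr_norml; lra.
have imc : mu.-integrable `[(- m), m] (EFin \o f).
  apply: continuous_compact_integrable; first exact: segment_compact.
  apply: within_continuous_pt => z; rewrite in_itv/= => /andP[mz zm].
  by apply: cf; rewrite (lt_le_trans _ mz) ?ltrN2// (le_lt_trans zm).
have im : mu.-integrable `](- m), m] (EFin \o f).
  by apply: integrableS imc => //; exact: subset_itv_oc_cc.
pose G x := \int[mu]_(t in `](- m), x]) f t.
have imS y : y < m -> mu.-integrable `](- m), y] (EFin \o f).
  move=> ym; apply: integrableS im => //.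
  by apply: subset_itvl; rewrite bnd_simp ltW.
have KG y : - m < y < m -> K y = G y - G 0.
  move=> /andP[my ym]; rewrite /K; case: leP => y0.
    by rewrite /G (Rintegral_itvB (imS y ym))// bnd_simp; lra.
  by rewrite /G -(Rintegral_itvB (imS 0 m0) (x := y)) ?bnd_simp ?opprB//; lra.
have [dG G'] : derivable G x 1 /\ derive1 G x = f x.
  apply: (@continuous_FTC1 _ f _ x m) => //.
  by apply: cf; rewrite bx.
have DG : is_derive x 1 G (f x).
  by apply: DeriveDef; [exact: dG|rewrite -derive1E].
apply: (@near_eq_is_derive _ _ _ (fun y => G y - G 0)).
  near=> y; rewrite KG//.
  have : y \in `](- m), m[ by near: y; apply: near_in_itvoo; rewrite in_itv/= mx.
  by rewrite in_itv.
by apply: is_derive_eq; rewrite oppr0 addr0.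
Unshelve. all: by end_near. Qed.

End primitive.

(** * The primitive of ln (2 cos x) and Catalan's constant *)

Section special_angles.
Context {R : realType}.

Lemma cos_pi4_sqr : cos (pi / 4) ^+ 2 = 1 / 2 :> R.
Proof.
have := cos_mulr2n (pi / 4 : R); have -> : pi / 4 *+ 2 = pi / 2 :> R.
  by rewrite mulr2n; field.
rewrite cos_pihalf => /eqP; rewrite eq_sym subr_eq add0r mulr2n => /eqP h; lra.
Qed.

Lemma cos_pi3 : cos (pi / 3) = 1 / 2 :> R.
Proof.
set c := cos (pi / 3).
have c0 : 0 < c by apply: cos_gt0_pihalf; have := @pi_gt0 R; lra.
have c2 : cos (pi / 3 *+ 2) = 2 * c ^+ 2 - 1 by rewrite cos_mulr2n mulr2n -/c; ring.
have : cos (pi / 3 *+ 2 + pi / 3) = -1 :> R.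
  by rewrite -[RHS]cospi; congr cos; rewrite mulr2n; field.
rewrite cosD c2 sin_mulr2n -/c.
have : sin (pi / 3 : R) ^+ 2 = 1 - c ^+ 2 by exact: sin2cos2.
set s := sin _ => s2 h.
(* the triple angle formula at pi / 3, that is, 4 c^3 - 3 c = -1, factored *)
have : (c + 1) * (2 * c - 1) ^+ 2 = 0.
  have : c * s *+ 2 * s = 2 * c * s ^+ 2 by rewrite mulr2n; ring.
  move=> hs; rewrite hs s2 in h.
  have -> : (c + 1) * (2 * c - 1) ^+ 2 = (2 * c ^+ 2 - 1) * c - 2 * c * (1 - c ^+ 2) + 1 by ring.
  by rewrite h addNr.
move/eqP; rewrite mulf_eq0 sqrf_eq0 => /orP[/eqP h1|/eqP h1]; lra.
Qed.

Lemma cos_pi6_sqr : cos (pi / 6) ^+ 2 = 3 / 4 :> R.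
Proof.
have := cos_mulr2n (pi / 6 : R); have -> : pi / 6 *+ 2 = pi / 3 :> R.
  by rewrite mulr2n; field.
by rewrite cos_pi3 [_ ^+ 2 *+ 2]mulr2n => h; lra.
Qed.

(** For fixed a, the left-hand side is a function of [cos x ^+ 2]: this
    evaluates sums of two values of ln (2 cos x) at angles symmetric around x. *)
Lemma cosD_cosB (x a : R) :
  cos (x + a) * cos (x - a) = cos x ^+ 2 + cos a ^+ 2 - 1.
Proof.
rewrite cosD cosB.
transitivity (cos x ^+ 2 * cos a ^+ 2 - sin x ^+ 2 * sin a ^+ 2); first by ring.
by rewrite !sin2cos2; ring.
Qed.

End special_angles.

Section log_cosine.
Context {R : realType}.
Implicit Types (x z v : R).

Let H x := ln (2 * cos x).

Let cos_gt0 x : - (pi / 2) < x < pi / 2 -> 0 < 2 * cos x.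
Proof. by move=> /cos_gt0_pihalf cx; rewrite mulr_gt0. Qed.

Let HM x y z : - (pi / 2) < x < pi / 2 -> - (pi / 2) < y < pi / 2 ->
   2 * cos x * (2 * cos y) = z -> H x + H y = ln z.
Proof.
by move=> /cos_gt0 hx /cos_gt0 hy <-; rewrite /H -lnM.
Qed.

Lemma log_cosine_primitive : exists K : R -> R, K 0 = 0 /\
  forall x, - (pi / 2) < x < pi / 2 -> is_derive x 1 K (ln (2 * cos x)).
Proof.
apply: primitive_exists.
move=> x /cos_gt0 hx; rewrite /prop_for /continuous_at; continuity_tac.
exact: hx.
Qed.

Variable K : R -> R.
Hypothesis K0 : K 0 = 0.
Hypothesis dK : forall x, - (pi / 2) < x < pi / 2 -> is_derive x 1 K (H x).

Let dKc (g : R -> R) x b : is_derive x 1 g b -> - (pi / 2) < g x < pi / 2 ->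
  is_derive x 1 (fun y => K (g y)) (H (g x) * b).
Proof. by move=> gb gx; apply: is_derive1_fun_comp => //; exact: dK. Qed.

Let HN x : H (- x) = H x. Proof. by rewrite /H cosN. Qed.

Let dlin (a b x : R) : is_derive x 1 (fun x => a * x + b) a.
Proof. by apply: is_derive_eq; rewrite /GRing.scale/=; ring. Qed.

Let p0 : 0 < pi :> R. Proof. exact: pi_gt0. Qed.

Lemma log_cosine_odd x : - (pi / 2) < x < pi / 2 -> K (- x) = - K x.
Proof.
move=> xpi; apply/eqP; rewrite -addr_eq0 addrC; apply/eqP.
have -> : 0 = K 0 + K (- 0) by rewrite oppr0 K0 addr0.
apply: (@is_derive0_eq _ (fun x => K x + K (- x)) (- (pi / 2)) (pi / 2)) => //; last lra.
move=> z zpi.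
have D1 : is_derive z 1 (fun x : R => - x) (- 1) by apply: is_derive_eq.
have /(dKc _ _ _ D1) D2 : - (pi / 2) < - z < pi / 2 by lra.
apply: (is_derive1_cast (is_deriveD (dK _ zpi) D2)).
by rewrite HN; ring.
Qed.

(** Differentiated, this is 2 cos (2 z) = 2 cos (z + pi/4) * 2 cos (z - pi/4);
    at z = 0 both sides vanish, because K is odd. *)
Lemma log_cosine_duplication z : - (pi / 4) < z < pi / 4 ->
  K (2 * z) / 2 = K (z + pi / 4) + K (z - pi / 4).
Proof.
move=> zpi; apply/eqP; rewrite -subr_eq0; apply/eqP.
pose F z := K (2 * z + 0) / 2 - (K (1 * z + pi / 4) + K (1 * z + - (pi / 4))).
have -> : K (2 * z) / 2 - (K (z + pi / 4) + K (z - pi / 4)) = F z.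
  by rewrite /F !mul1r addr0.
have -> : 0 = F 0.
  rewrite /F !mulr0 !add0r K0 log_cosine_odd; last by lra.
  by rewrite subrr mul0r subr0.
apply: (@is_derive0_eq _ F (- (pi / 4)) (pi / 4)) => //; last lra.
move=> {}z {}zpi.
have D1 := dKc _ _ _ (dlin 2 0 z) ltac:(cbv beta; lra).
have D2 := dKc _ _ _ (dlin 1 (pi / 4) z) ltac:(cbv beta; lra).
have D3 := dKc _ _ _ (dlin 1 (- (pi / 4)) z) ltac:(cbv beta; lra).
have D4 := is_deriveB (is_derive1_divr 2 D1) (is_deriveD D2 D3).
apply: (is_derive1_cast D4).
rewrite !mulr1 !mul1r addr0.
rewrite (HM _ _ (2 * cos (2 * z))) ?/H; [|lra|lra|]; last first.
  rewrite mulrACA cosD_cosB cos_pi4_sqr.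
  by rewrite (_ : 2 * z = z *+ 2) ?mulr_natl// cos_mulr2n mulr2n; field.
by field.
Qed.

(** Differentiated, this is the factorisation of 2 cos (3 z) as the product of
    the 2 cos (z + j pi/3), j = -1, 0, 1. *)
Lemma log_cosine_triplication z : - (pi / 6) < z < pi / 6 ->
  K (3 * z) / 3 = K z + K (z + pi / 3) + K (z - pi / 3).
Proof.
move=> zpi; apply/eqP; rewrite -subr_eq0; apply/eqP.
pose F z := K (3 * z + 0) / 3 -
  (K (1 * z + 0) + K (1 * z + pi / 3) + K (1 * z + - (pi / 3))).
have -> : K (3 * z) / 3 - (K z + K (z + pi / 3) + K (z - pi / 3)) = F z.
  by rewrite /F !mul1r !addr0.
have -> : 0 = F 0.
  rewrite /F !mulr0 !add0r K0 (@log_cosine_odd (pi / 3)); last by lra.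
  by rewrite add0r subrr mul0r subr0.
apply: (@is_derive0_eq _ F (- (pi / 6)) (pi / 6)) => //; last lra.
move=> {}z {}zpi.
have D0 := dKc _ _ _ (dlin 1 0 z) ltac:(cbv beta; lra).
have D1 := dKc _ _ _ (dlin 3 0 z) ltac:(cbv beta; lra).
have D2 := dKc _ _ _ (dlin 1 (pi / 3) z) ltac:(cbv beta; lra).
have D3 := dKc _ _ _ (dlin 1 (- (pi / 3)) z) ltac:(cbv beta; lra).
have D4 := is_deriveB (is_derive1_divr 3 D1)
  (is_deriveD (is_deriveD D0 D2) D3).
apply: (is_derive1_cast D4).
rewrite !mulr1 !mul1r !addr0.
have [c0 c1 c2] : [/\ 0 < 2 * cos z, 0 < 2 * cos (z + pi / 3) &
   0 < 2 * cos (z - pi / 3)] by split; apply: cos_gt0; lra.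
rewrite -[H z + _ + _]addrA [X in H z + X](HM _ _ (4 * cos z ^+ 2 - 3)); [|lra|lra|]; last first.
  by rewrite mulrACA cosD_cosB cos_pi3; field.
have c3 : 2 * cos (3 * z) = 2 * cos z * (4 * cos z ^+ 2 - 3).
  have -> : 3 * z = z *+ 2 + z by rewrite mulr2n; ring.
  rewrite cosD cos_mulr2n sin_mulr2n.
  transitivity (2 * ((2 * cos z ^+ 2 - 1) * cos z - 2 * cos z * sin z ^+ 2)).
    by rewrite !mulr2n; ring.
  by rewrite sin2cos2; ring.
have c4 : 0 < 4 * cos z ^+ 2 - 3.
  by rewrite -(pmulr_rgt0 _ c0) -c3; apply: cos_gt0; lra.
rewrite /H c3 lnM ?posrE//.
by field.
Qed.

Let atan_itv v : 0 <= v <= 1 -> 0 <= atan v <= pi / 4.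
Proof.
by move=> /andP[v0 v1]; rewrite -{1}(atan0 R) -atan1 !le_atan.
Qed.

Let atan_pihalf v : - (pi / 2) < atan v < pi / 2.
Proof. by rewrite atan_gtNpi2 atan_ltpi2. Qed.

(** This is how the integrals in v become integrals of ln (2 cos x). *)
Lemma ln_cos_atan v : H (atan v) = ln 2 - ln (1 + v ^+ 2) / 2.
Proof.
rewrite /H cos_atan lnM ?posrE// ?invr_gt0 ?sqrtr_gt0//.
rewrite lnV ?posrE ?sqrtr_gt0//; congr (_ - _).
rewrite -[in RHS](sqr_sqrtr (ltW (oneDsqr_pos v))) lnXn ?sqrtr_gt0//.
by rewrite mulr2n; field.
Qed.

Lemma integral_ln_oneDsqr :
  (\int[lebesgue_measure]_(v in `]0%R, 1%R]) (ln (1 + v ^+ 2) / (1 + v ^+ 2))%:E =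
   (pi / 2 * ln 2 - 2 * K (pi / 4))%:E)%E.
Proof.
rewrite (@integral_itv_bnd_ftc _ (fun v => 2 * ln 2 * atan v - 2 * K (atan v))).
- by rewrite atan1 atan0 K0; congr (_%:E); field.
- exact: ler01.
- move=> v; rewrite in_itv/= => /atan_itv vpi.
  have D1 := dKc _ _ _ (is_derive1_atan v) (atan_pihalf v).
  apply: (is_derive1_cast (is_deriveB
    (is_deriveZ (2 * ln 2) (is_derive1_atan v)) (is_deriveZ 2 D1))).
  by rewrite ln_cos_atan /GRing.scale/=; field; rewrite gt_eqF.
- move=> v _; rewrite /prop_for /continuous_at; continuity_tac => //.
  by rewrite gt_eqF.
Qed.

(** With v = tan x, (3 - v^2) / (1 + v^2) = 2 cos (x + pi/6) * 2 cos (x - pi/6),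
    whence a primitive in terms of K.  The values of K at 5 pi/12 and pi/12 that
    it takes at v = 1 are combined by triplication at pi/12. *)
Lemma integral_ln_threeBsqr :
  (\int[lebesgue_measure]_(v in `]0%R, 1%R])
     (ln (4 / (3 - v ^+ 2)) / (1 + v ^+ 2))%:E = (2 / 3 * K (pi / 4))%:E)%E.
Proof.
have pi0 := @pi_gt0 R.
have v3 v : v \in `[0, 1] -> 0 < 3 - v ^+ 2.
  rewrite in_itv/= => /andP[v0 v1].
  have ? : v ^+ 2 <= 1 by rewrite expr_le1.
  lra.
rewrite (@integral_itv_bnd_ftc _ (fun v => 2 * K (atan v)
   - (K (atan v + pi / 6) + K (atan v + - (pi / 6))))).
- rewrite atan1 atan0 K0 !add0r log_cosine_odd; last lra.
  have trip := @log_cosine_triplication (pi / 12) ltac:(lra).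
  rewrite (_ : 3 * (pi / 12) = pi / 4) in trip; last by field.
  rewrite (_ : pi / 12 - pi / 3 = - (pi / 4)) in trip; last by field.
  rewrite log_cosine_odd in trip; last lra.
  rewrite (_ : pi / 4 + pi / 6 = pi / 12 + pi / 3); last by field.
  rewrite (_ : pi / 4 + - (pi / 6) = pi / 12); last by field.
  by congr (_%:E); lra.
- exact: ler01.
- move=> v v01; have v31 := v3 _ v01; have := oneDsqr_pos v => v1.
  move: v01; rewrite in_itv/= => /atan_itv vpi.
  have D1 := dKc _ _ _ (is_derive1_atan v) (atan_pihalf v).
  have Dc (a : R) : is_derive v 1 (fun v : R => atan v + a) (1 + v ^+ 2)^-1.
    by apply: is_derive_eq; rewrite addr0.
  have D2 := dKc _ _ _ (Dc (pi / 6)) ltac:(cbv beta; lra).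
  have D3 := dKc _ _ _ (Dc (- (pi / 6))) ltac:(cbv beta; lra).
  apply: (is_derive1_cast (is_deriveB (is_deriveZ 2 D1) (is_deriveD D2 D3))).
  rewrite /GRing.scale/= -mulrDl.
  rewrite (HM _ _ ((3 - v ^+ 2) / (1 + v ^+ 2))); [|lra|lra|]; last first.
    rewrite mulrACA cosD_cosB cos_pi6_sqr cos_atan exprVn sqr_sqrtr ?ltW//.
    by field; rewrite gt_eqF.
  rewrite ln_cos_atan !ln_div ?posrE// (_ : 4 = 2 ^+ 2) ?lnXn//; last by rewrite -natrX.
  by rewrite mulr2n; field; rewrite gt_eqF.
- move=> v v01; rewrite /prop_for /continuous_at; continuity_tac => //.
  + by rewrite divr_gt0// v3.
  + by rewrite gt_eqF// v3.
  + by rewrite gt_eqF.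
Qed.

(** On [0, pi/4] one has 1 < 2 cos, so that the derivative of K lies in
    [0, 1]. *)
Lemma log_cosine_small x : 0 <= x <= pi / 4 -> `|K x| <= x.
Proof.
have pi0 := @pi_gt0 R; move=> /andP[x0 xpi].
have [z|c /andP[c0 cx]] := is_derive_mvt K H 0 x x0.
  by move=> /andP[z0 zx]; apply: dK; lra.
rewrite K0 !subr0 => ->.
have cos1 : 1 < 2 * cos c.
  have : cos (pi / 3) < cos c.
    by rewrite ltr_cos ?in_itv/=; lra.
  by rewrite cos_pi3; lra.
have H0 : 0 <= H c by apply: ln_ge0; exact: ltW.
have H1 : H c <= 1.
  have /le_ln1Dx : -1 < 2 * cos c - 1 by lra.
  rewrite (_ : 1 + (2 * cos c - 1) = 2 * cos c); last by ring.
  by have := cos_le1 c; rewrite /H; lra.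
by rewrite normrM (ger0_norm H0) (ger0_norm x0) ler_piMl.
Qed.

(* The behaviour of K at the end point pi/2, where its derivative is unbounded,
   is read off the duplication formula, which relates K (pi / 2 - x) to
   K (pi / 2 - 2 x): it is enough to approach pi/2 along the points
   pi / 2 - xn n. *)
Let xn n : R := pi / 4 * 2^-1 ^+ n.

Let xn_itv n : 0 < xn n <= pi / 4.
Proof.
have pi0 := @pi_gt0 R.
have p : 0 < 2^-1 ^+ n :> R by rewrite exprn_gt0.
by rewrite /xn mulr_gt0 ?divr_gt0//= ler_piMr// ?exprn_ile1//; lra.
Qed.

Let xnS n : xn n = 2 * xn n.+1.
Proof. by rewrite /xn exprS; field. Qed.

Let log_cosine_end_rec n :
  K (pi / 2 - xn n.+1) = K (xn n.+1) + K (pi / 2 - xn n) / 2.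
Proof.
have pi0 := @pi_gt0 R; have := xn_itv n; rewrite xnS; set x := xn n.+1 => xpi.
have := @log_cosine_duplication (pi / 4 - x) ltac:(lra).
rewrite (_ : 2 * (pi / 4 - x) = pi / 2 - 2 * x); last by field.
rewrite (_ : pi / 4 - x + pi / 4 = pi / 2 - x); last by field.
rewrite (_ : pi / 4 - x - pi / 4 = - x); last by field.
by rewrite log_cosine_odd; lra.
Qed.

(* The recurrence halves K (pi / 2 - xn n) and adds at most
   xn n.+1 <= (3 / 4) ^+ n / 2.  Any ratio strictly between 1/2 and 1 leaves room
   for that term; with 3/4 it is absorbed by the constant 2, since
   1/2 <= 2 * (3/4 - 1/2). *)
Let log_cosine_end_le n :
  `|K (pi / 2 - xn n)| <= (`|K (pi / 4)| + 2) * (3 / 4) ^+ n.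
Proof.
elim: n => [|n IH].
  rewrite /xn !expr0 !mulr1 (_ : pi / 2 - pi / 4 = pi / 4); last by field.
  lra.
have /andP[x0 x1] := xn_itv n.+1.
rewrite log_cosine_end_rec (le_trans (ler_normD _ _))//.
have xs : xn n.+1 <= 1 / 2 * (3 / 4) ^+ n.
  rewrite /xn exprS (_ : pi / 4 * _ = pi / 2 / 2 * (1 / 2 * 2^-1 ^+ n)); last by field.
  have ? : 2^-1 ^+ n <= (3 / 4) ^+ n :> R by rewrite lerXn2r ?nnegrE; lra.
  have ? : 0 <= 2^-1 ^+ n :> R by rewrite exprn_ge0.
  have ? : pi / 2 / 2 <= 1 :> R by have := @pihalf_lt2 R; lra.
  by apply: (@le_trans _ _ (1 / 2 * 2^-1 ^+ n)); [rewrite ler_piMl//; lra|lra].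
have := log_cosine_small (xn n.+1); rewrite (ltW x0) => /(_ x1) Kx.
have : `|K (pi / 2 - xn n) / 2| <= (`|K (pi / 4)| + 2) * (3 / 4) ^+ n / 2.
  by rewrite normrM (@ger0_norm _ 2^-1)// ler_pM2r.
rewrite exprS; set q := (3 / 4) ^+ n in xs *.
have ? : 0 <= q by rewrite exprn_ge0.
have ? : 0 <= `|K (pi / 4)| * q by rewrite mulr_ge0.
by lra.
Qed.

(* Partial sums of the power series of the arctangent and of the inverse
   tangent integral, the primitive of atan v / v; the second series is that of
   Catalan's constant at v = 1. *)
Let atan_sum N v : R := \sum_(i < N) (-1) ^+ i / (2 * i%:R + 1) * v ^+ (2 * i).+1.
Let ti_sum N v : R := \sum_(i < N) (-1) ^+ i / (2 * i%:R + 1) ^+ 2 * v ^+ (2 * i).+1.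

Let odd_neq0 i : 2 * i%:R + 1 != 0 :> R.
Proof. by rewrite gt_eqF// ltr_wpDl// mulr_ge0. Qed.

Let natr_odd i : (2 * i).+1%:R = 2 * i%:R + 1 :> R.
Proof. by rewrite -natr1 natrM. Qed.

Let dXn n (v : R) : is_derive v 1 (fun v => v ^+ n.+1) (n.+1%:R * v ^+ n).
Proof.
have -> : (fun v : R => v ^+ n.+1) = id ^+ n.+1 by apply/funext => u; rewrite exprfctE.
by apply: is_derive_eq; rewrite /GRing.scale/= mulr1.
Qed.

Let d_atan_sum N v :
  is_derive v 1 (atan_sum N) ((1 - (- v ^+ 2) ^+ N) / (1 + v ^+ 2)).
Proof.
have -> : (1 - (- v ^+ 2) ^+ N) / (1 + v ^+ 2) = \sum_(i < N) (-1) ^+ i * v ^+ (2 * i).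
  have := subrX1 (- v ^+ 2) N => h.
  have -> : 1 - (- v ^+ 2) ^+ N = (1 + v ^+ 2) * \sum_(i < N) (- v ^+ 2) ^+ i.
    by rewrite -opprB h; ring.
  rewrite mulrAC divff ?gt_eqF// mul1r; apply: eq_bigr => i _.
  by rewrite (exprNn (v ^+ 2)) exprM.
apply: (@is_derive1_bigsum _ N (fun i v => (-1) ^+ i / (2 * i%:R + 1) * v ^+ (2 * i).+1)
  (fun i => (-1) ^+ i * v ^+ (2 * i))) => i.
apply: (is_derive1_cast (is_deriveZ _ (dXn (2 * i) v))).
by rewrite /GRing.scale/= natr_odd; field; exact: odd_neq0.
Qed.

Let d_ti_sum N v : 0 < v -> is_derive v 1 (ti_sum N) (atan_sum N v / v).
Proof.
move=> v0; rewrite /atan_sum mulr_suml.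
apply: (@is_derive1_bigsum _ N (fun i v => (-1) ^+ i / (2 * i%:R + 1) ^+ 2 * v ^+ (2 * i).+1)
  (fun i => (-1) ^+ i / (2 * i%:R + 1) * v ^+ (2 * i).+1 / v)) => i.
apply: (is_derive1_cast (is_deriveZ _ (dXn (2 * i) v))).
rewrite /GRing.scale/= natr_odd [v ^+ _.+1]exprS; field.
by rewrite odd_neq0 gt_eqF.
Qed.

Let ln_mul_le1 (u : R) : 0 < u -> u <= 1 -> `|ln u| * u <= 1.
Proof.
move=> u0 u1; rewrite ler0_norm ?ln_le0// -lnV ?posrE//.
have := @ln_sublinear R u^-1; rewrite invr_gt0 => /(_ u0) /ltW h.
by rewrite -(ler_pM2r u0) mulVf ?gt_eqF// in h.
Qed.

(* At v = 1 this is the error of the partial sum of Catalan's series, and it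
   tends to 0 with v.  In the derivative, K contributes - ln v / (1 + v ^+ 2) and
   the partial sums the same, up to the remainder of a geometric series. *)
Let diff N v := ti_sum N v - ln v * atan_sum N v - (K (atan v) + K (pi / 2 - atan v)).

Let d_diff N v : 0 < v ->
  is_derive v 1 (diff N) (ln v * (- v ^+ 2) ^+ N / (1 + v ^+ 2)).
Proof.
move=> v0; have pi0 := @pi_gt0 R.
have a0 : 0 < atan v by rewrite -(atan0 R) lt_atan.
have api := atan_pihalf v.
have D1 := dKc _ _ _ (is_derive1_atan v) api.
have Dc : is_derive v 1 (fun v : R => pi / 2 - atan v) (- (1 + v ^+ 2)^-1).
  by apply: is_derive_eq; rewrite add0r mul1r.
have D2 := dKc _ _ _ Dc ltac:(cbv beta; lra).
have D3 := is_deriveB (is_deriveB (d_ti_sum N v v0)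
  (is_deriveM (is_derive1_ln v0) (d_atan_sum N v))) (is_deriveD D1 D2).
apply: (is_derive1_cast D3).
have -> : H (pi / 2 - atan v) = ln v + H (atan v).
  have cv : 0 < cos (atan v) by exact: cos_gt0_pihalf.
  have sv : sin (atan v) = v * cos (atan v).
    by rewrite -{2}(atanK v) /tan divfK ?gt_eqF.
  rewrite /H -lnM ?posrE ?mulr_gt0//; congr ln.
  by rewrite cosB cos_pihalf mul0r add0r sin_pihalf mul1r sv; ring.
by rewrite /GRing.scale/=; field; rewrite !gt_eqF.
Qed.

Let diff_le N v : 0 < v <= 1 -> `|diff N.+1 1 - diff N.+1 v| <= (2 * N.+1%:R)^-1.
Proof.
move=> /andP[v0 v1].
have n0 : 2 * N.+1%:R != 0 :> R by rewrite mulf_neq0// pnatr_eq0.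
(* |ln u| * u <= 1 bounds the derivative of [diff N.+1] at u by
   u ^+ (2 * N).+1: both E 1 and E (-1) are non-decreasing. *)
pose E (s : R) (v : R) := v ^+ (2 * N).+2 / (2 * N.+1%:R) + s * diff N.+1 v.
have dE s (u : R) : 0 < u -> is_derive u 1 (E s)
    (u ^+ (2 * N).+1 + s * (ln u * (- u ^+ 2) ^+ N.+1 / (1 + u ^+ 2))).
  move=> u0; have D1 := dXn (2 * N).+1 u.
  apply: (is_derive1_cast (is_deriveD (is_derive1_divr (2 * N.+1%:R) D1)
    (is_deriveZ s (d_diff N.+1 u u0)))).
  rewrite /GRing.scale/=; congr (_ + _).
  have -> : (2 * N).+2%:R = 2 * N.+1%:R :> R by rewrite -natrM mulnS.
  by rewrite mulrAC divff// mul1r.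
have E1 s : `|s| = 1 -> E s v <= E s 1.
  move=> s1; apply: (@is_derive_le _ (E s)
    (fun u => u ^+ (2 * N).+1 + s * (ln u * (- u ^+ 2) ^+ N.+1 / (1 + u ^+ 2)))) => //.
    by move=> u /andP[vu _]; apply: dE; exact: lt_le_trans vu.
  move=> u /andP[vu u1]; have u0 : 0 < u by exact: lt_le_trans vu.
  set X := (X in s * X); set A := u ^+ _.
  suff : `|s * X| <= A by rewrite ler_norml => /andP[h _]; lra.
  rewrite /X /A normrM s1 mul1r !normrM normrX normrN (@ger0_norm _ (u ^+ 2)) ?sqr_ge0//.
  rewrite (@ger0_norm _ (_ ^-1)) ?invr_ge0 ?(ltW (oneDsqr_pos u))//.
  rewrite ler_pdivrMr//.
  have lu := ln_mul_le1 u u0 u1.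
  have -> : `|ln u| * u ^+ 2 ^+ N.+1 = `|ln u| * u * u ^+ (2 * N).+1.
    by rewrite -exprM mulnS !exprS; ring.
  have ui : 0 <= u ^+ (2 * N).+1 by rewrite exprn_ge0// ltW.
  apply: (@le_trans _ _ (u ^+ (2 * N).+1)); first by rewrite ler_piMl.
  by rewrite ler_peMr// lerDl sqr_ge0.
have vN : 0 <= v ^+ (2 * N).+2 / (2 * N.+1%:R).
  by apply: divr_ge0; [rewrite exprn_ge0// ltW|rewrite mulr_ge0].
have := E1 1 (normr1 _); have := E1 (-1) ltac:(by rewrite normrN normr1).
rewrite /E expr1n !div1r !mul1r !mulN1r ler_norml.
set w := _^-1; move: vN; set z := _ * w => z0 *; lra.
Qed.

Let odd_sum_le N k v : 0 <= v <= 1 ->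
  `|\sum_(i < N) (-1) ^+ i / (2 * i%:R + 1) ^+ k * v ^+ (2 * i).+1| <= N%:R * v.
Proof.
move=> /andP[v0 v1]; rewrite (le_trans (ler_norm_sum _ _ _))//.
rewrite mulr_natl -[in leRHS](card_ord N) -sumr_const; apply: ler_sum => i _.
rewrite !normrM normrX normrN1 expr1n mul1r normfV normrX exprS.
have o1 : 1 <= 2 * i%:R + 1 :> R by rewrite lerDr mulr_ge0.
rewrite (@ger0_norm _ (_ * _ ^+ _)) ?mulr_ge0 ?exprn_ge0//.
rewrite (@ger0_norm _ (2 * _ + 1)) ?(le_trans ler01)//.
rewrite ler_pdivrMl ?exprn_gt0 ?(lt_le_trans ltr01)//.
apply: (@le_trans _ _ (v * 1)); first by rewrite ler_wpM2l// exprn_ile1.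
by rewrite mulrC ler_wpM2r// exprn_ege1.
Qed.

(* The bound for ln v * atan_sum N v uses |ln w| * w <= 1 at w = sqrt v. *)
Let diff_small N n : `|diff N (tan (xn n))| <=
  3 * N%:R * Num.sqrt (tan (xn n)) + xn n + (`|K (pi / 4)| + 2) * (3 / 4) ^+ n.
Proof.
have pi0 := @pi_gt0 R; have /andP[x0 x1] := xn_itv n.
have atanx : atan (tan (xn n)) = xn n by rewrite tanK// in_itv/=; lra.
set v := tan (xn n).
have v0 : 0 < v by rewrite -tan0 ltr_tan ?in_itv/=; lra.
have v1 : v <= 1.
  by rewrite -tan_piquarter leNgt ltr_tan -?leNgt// in_itv/=; lra.
have v01 : 0 <= v <= 1 by rewrite v1 ltW.
set w := Num.sqrt v.
have w0 : 0 < w by rewrite sqrtr_gt0.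
have w1 : w <= 1 by rewrite -sqrtr1 ler_wsqrtr.
have vw : v = w ^+ 2 by rewrite sqr_sqrtr// ltW.
have vlew : v <= w by rewrite vw expr2 ler_piMl// ltW.
have hT : `|ti_sum N v| <= N%:R * w.
  by apply: (le_trans (odd_sum_le N 2 v v01)); rewrite ler_wpM2l.
have hA : `|ln v * atan_sum N v| <= 2 * N%:R * w.
  have hA : `|atan_sum N v| <= N%:R * v by exact: (odd_sum_le N 1 v v01).
  rewrite normrM (le_trans (ler_wpM2l (normr_ge0 _) hA))//.
  have := ln_mul_le1 w w0 w1; rewrite vw lnXn// normrMn => lw.
  have -> : `|ln w| *+ 2 * (N%:R * w ^+ 2) = 2 * N%:R * w * (`|ln w| * w).
    by rewrite -[`|ln w| *+ 2]mulr_natl; ring.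
  by rewrite ler_piMr// !mulr_ge0// ltW.
have hK : `|K (atan v)| <= xn n.
  by rewrite atanx log_cosine_small// x1 ltW.
have hE := log_cosine_end_le n; rewrite -atanx -/v in hE.
rewrite /diff (le_trans (ler_normB _ _))//.
have h1 := ler_normB (ti_sum N v) (ln v * atan_sum N v).
have h2 := ler_normD (K (atan v)) (K (pi / 2 - atan v)).
by lra.
Qed.

Let xn_cvg : xn n @[n --> \oo] --> 0.
Proof.
rewrite -[X in _ --> X](mulr0 (pi / 4)); apply: cvgM; first exact: cvg_cst.
by apply: cvg_expr; rewrite ger0_norm//; lra.
Qed.

(** The derivative bound is integrated from v = tan (xn n) to 1, and n tends to
    infinity. *)
Lemma odd_square_series_le N :
  `|\sum_(i < N.+1) (-1) ^+ i / (2 * i%:R + 1) ^+ 2 - 2 * K (pi / 4)|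
    <= (2 * N.+1%:R)^-1.
Proof.
have pi0 := @pi_gt0 R.
have diff1 : diff N.+1 1 =
    \sum_(i < N.+1) (-1) ^+ i / (2 * i%:R + 1) ^+ 2 - 2 * K (pi / 4).
  rewrite /diff ln1 mul0r subr0 atan1 (_ : pi / 2 - pi / 4 = pi / 4); last by field.
  congr (_ - _); last by ring.
  by apply: eq_bigr => i _; rewrite expr1n mulr1.
rewrite -diff1; apply/ler_addgt0Pr => e e0.
pose b n := 3 * N.+1%:R * Num.sqrt (tan (xn n)) + xn n +
  (`|K (pi / 4)| + 2) * (3 / 4) ^+ n.
have b_cvg : b n @[n --> \oo] --> 0.
  rewrite (_ : 0 = 3 * N.+1%:R * Num.sqrt (tan 0) + 0 + (`|K (pi / 4)| + 2) * 0 :> R); last first.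
    by rewrite tan0 sqrtr0 !mulr0 !addr0.
  apply: cvgD; last first.
    apply: cvgM; first exact: cvg_cst.
    by apply: cvg_expr; rewrite ger0_norm//; lra.
  apply: cvgD; last exact: xn_cvg.
  apply: cvgM; first exact: cvg_cst.
  apply: (@continuous_cvg _ _ _ _ _ _ (@Num.sqrt R)); first exact: sqrt_continuous.
  apply: (@continuous_cvg _ _ _ _ _ _ (@tan R)) xn_cvg.
  by apply: continuous_tan; rewrite cos0 oner_neq0.
have /cvgr0Pnorm_le /(_ e e0) [n _ /(_ n (leqnn n))] := b_cvg.
move=> /(le_trans (ler_norm _)) bn.
have dn := diff_small N.+1 n.
have /andP[x0 x1] := xn_itv n.
have v0 : 0 < tan (xn n) by rewrite -tan0 ltr_tan ?in_itv/=; lra.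
have v1 : tan (xn n) <= 1.
  by rewrite -tan_piquarter leNgt ltr_tan -?leNgt// in_itv/=; lra.
have := diff_le N (tan (xn n)); rewrite v0 v1 => /(_ isT) dd.
have := ler_normD (diff N.+1 1 - diff N.+1 (tan (xn n))) (diff N.+1 (tan (xn n))).
rewrite subrK => h; apply: (le_trans h); apply: lerD dd _; exact: le_trans dn bn.
Qed.

Lemma catalan_log_cosine : catalan R = 2 * K (pi / 4).
Proof.
rewrite /catalan; apply/cvg_lim; first exact: Rhausdorff.
rewrite -cvg_shiftS.
apply/(@cvgrPdist_le _ R^o) => e e0.
near=> N.
rewrite /= big_add1/= big_mkord distrC.
have odd_shift i : 2 * i.+1%:R - 1 = 2 * i%:R + 1 :> R.
  by rewrite -(natr1 i); ring.
under eq_bigr do rewrite odd_shift.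
rewrite (le_trans (odd_square_series_le N))//.
apply: (@le_trans _ _ (N.+1%:R^-1)).
  by rewrite lef_pV2 ?posrE ?mulr_gt0// ler_peMl// ler1n.
by apply/ltW; near: N; exact: near_infty_natSinv_lt (PosNum e0).
Unshelve. all: by end_near. Qed.

End log_cosine.

(** * The law of xi and the mass of the lattice domain *)

Section plane_measure.
Context {R : realType}.
Local Notation mu := (@lebesgue_measure R).

(** A name for the product measure that carries its sigma-finiteness: the
    three-dimensional integral is iterated in two stages. *)
Definition leb2 : set (measurableTypeR R * measurableTypeR R) -> \bar R :=
  (mu \x mu)%E.

HB.instance Definition _ := Measure.on leb2.

Let leb2_sigma_finite : sigma_finite setT leb2.
Proof.
pose I n : set (measurableTypeR R) := `](- n%:R), n%:R]%classic.
exists (fun n => I n `*` I n).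
  apply/seteqP; split => // -[x y] _.
  have := @archi_boundP R (`|x| + `|y|) (addr_ge0 (normr_ge0 x) (normr_ge0 y)).
  set n := Num.bound _ => xyn; exists n => //.
  have Iz z : `|z| < n%:R -> I n z.
    by rewrite /I /= in_itv/= ltr_norml => /andP[-> /ltW ->].
  by split; apply: Iz; apply: le_lt_trans xyn; rewrite /= ?lerDl ?lerDr.
have Ifin n : (mu (I n) < +oo)%E.
  by rewrite lebesgue_measure_itv/=; case: ifP => _; rewrite -?EFinB ltry.
move=> n; split; first by apply: measurableX; exact: measurable_itv.
rewrite /leb2 product_measure1E; [|exact: measurable_itv|exact: measurable_itv].
apply: lte_mul_pinfty; [exact: measure_ge0| |exact: Ifin].
by rewrite ge0_fin_numE ?measure_ge0//; exact: Ifin.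
Qed.

HB.instance Definition _ := Measure_isSigmaFinite.Build _ _ _ leb2
  leb2_sigma_finite.

End plane_measure.

Section lattice_law.
Context {R : realType} (d : measure_display) (T : measurableType d)
  (P : probability T R) (t y1 y2 : T -> R) (c : R).
Hypothesis density_ty : has_density P (leb3 R) (fun w => (t w, y1 w, y2 w))
  (fun u => c * u.1.1 * \1_(@lattice_domain R) u).
Local Notation mu := (@lebesgue_measure R).

(** The density at (1, 0, 0) is c. *)
Lemma density_constant_ge0 : 0 <= c.
Proof.
have [_ _ /(_ (1, 0, 0)) + _] := density_ty.
rewrite /= mulr1 indicE mem_set ?mulr1//.
by split; rewrite /= ?normr0 ?expr0n ?expr1n ?mulr0 ?add0r ?divr1.
Qed.

Lemma law_lattice_mass (A : set R) : measurable A ->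
  (P ((fun w => xi (t w) (y1 w) (y2 w)) @^-1` A) = c%:E * lattice_mass A)%E.
Proof.
move=> mA; have [mX _ _ PE] := density_ty.
have c0 := density_constant_ge0.
pose B := (fun u : R * R * R => xi u.1.1 u.1.2 u.2) @^-1` A.
have mB : measurable B by rewrite -[B]setTI; exact: measurable_xi.
have -> : (fun w => xi (t w) (y1 w) (y2 w)) @^-1` A =
  (fun w => (t w, y1 w, y2 w)) @^-1` B by [].
rewrite PE//.
pose g (u : R * R * R) : \bar R :=
  (u.1.1 * (\1_(@lattice_domain R) u * \1_A (xi u.1.1 u.1.2 u.2)))%:E.
have mg : measurable_fun [set: R * R * R] g.
  apply/measurable_EFinP; apply: measurable_funM; first by measurability_tac.
  apply: measurable_funM; first exact: measurable_indic measurable_lattice_domain.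
  by apply: measurable_indic_comp => //; exact: measurable_xi.
have g0 u : (0 <= g u)%E.
  rewrite lee_fin indicE; case: (boolP (u \in _)) => [|_]; last by rewrite mul0r mulr0.
  by rewrite inE => -[u0 _ _ _]; rewrite !mulr_ge0// ltW.
transitivity (\int[leb3 R]_u (c%:E * g u))%E.
  rewrite integral_mkcond; apply: eq_integral => u _; rewrite patchE /g.
  case: ifPn => uB; rewrite -?EFinM.
    rewrite (_ : \1_A _ = 1) ?mulr1 ?mulrA//.
    by move: uB; rewrite inE => uB; rewrite indicE mem_set.
  rewrite (_ : \1_A _ = 0) ?mulr0//.
  by rewrite indicE memNset// => uA; move/negP: uB; apply; rewrite inE.
rewrite ge0_integralZl_EFin//; congr (_ * _)%E.
transitivity (\int[leb2]_u \int[mu]_z g (u, z))%E.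
  exact: (@fubini_tonelli1 _ _ _ _ R leb2 mu g mg g0).
apply: (@fubini_tonelli1 _ _ _ _ R mu mu (fun u => \int[mu]_z g (u, z))%E).
- exact: (@measurable_fun_fubini_tonelli_F _ _ _ _ R mu g mg g0).
- by move=> u; exact: integral_ge0.
Qed.

End lattice_law.

Arguments density_constant_ge0 {R d T P t y1 y2 c}.
Arguments law_lattice_mass {R d T P t y1 y2 c} density_ty {A}.

(** * Evaluation of the logarithmic integrals *)

Section log_integrals.
Context {R : realType}.
Local Notation mu := (@lebesgue_measure R).
Implicit Types x v : R.

Lemma integral_ln_oneDsqrE :
  (\int[mu]_(v in `]0%R, 1%R]) (ln (1 + v ^+ 2) / (1 + v ^+ 2))%:E =
   (pi / 2 * ln 2 - catalan R)%:E)%E.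
Proof.
have [K [K0 dK]] := @log_cosine_primitive R.
by rewrite (integral_ln_oneDsqr K K0 dK) (catalan_log_cosine K K0 dK).
Qed.

Lemma lattice_massT_catalan : lattice_mass [set: R] = (catalan R / 3)%:E.
Proof.
have [K [K0 dK]] := @log_cosine_primitive R.
rewrite lattice_massT (integral_ln_threeBsqr K K0 dK) (catalan_log_cosine K K0 dK).
by congr (_%:E); field.
Qed.

Let ln_ratio v x : 0 < x ->
  ln ((1 + v ^+ 2) / (4 * x ^+ 2)) = ln (1 + v ^+ 2) - ln (4 * x ^+ 2).
Proof. by move=> x0; rewrite ln_div// posrE ?mulr_gt0 ?exprn_gt0. Qed.

(** Here 4 x^2 < 1 <= 1 + v^2, so that the logarithm in the integrand is
    positive and splits. *)
Lemma logslope_low x : 0 < x < 1 / 2 ->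
  logslope x = (- (pi / 2 * ln x + catalan R))%:E.
Proof.
move=> /andP[x0 x12].
have x4 : 0 < 4 * x ^+ 2 by rewrite mulr_gt0// exprn_gt0.
have x41 : 4 * x ^+ 2 <= 1.
  have -> : 4 * x ^+ 2 = (2 * x) ^+ 2 by ring.
  by rewrite expr_le1// ?mulr_ge0 ?ltW//; lra.
have lx : ln (4 * x ^+ 2) <= 0 by exact: ln_le0.
transitivity (\int[mu]_(v in `]0%R, 1%R])
  ((ln (1 + v ^+ 2) / (1 + v ^+ 2))%:E + ((- ln (4 * x ^+ 2)) / (1 + v ^+ 2))%:E))%E.
  apply: eq_integral => v _; rewrite -EFinD; congr (_%:E).
  have lv : 0 <= ln (1 + v ^+ 2) by rewrite ln_ge0// lerDl sqr_ge0.
  rewrite ln_ratio// max_r; last by lra.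
  by rewrite mulrBl mulNr.
rewrite ge0_integralD//; last 4 first.
- by move=> v _; rewrite lee_fin divr_ge0 ?(ltW (oneDsqr_pos v))// ln_ge0// lerDl sqr_ge0.
- by apply: measurable_funTS; measurability_tac.
- by move=> v _; rewrite lee_fin divr_ge0 ?(ltW (oneDsqr_pos v))// oppr_ge0.
- by apply: measurable_funTS; measurability_tac.
rewrite integral_ln_oneDsqrE.
rewrite (@integral_itv_bnd_ftc _ (fun v => - ln (4 * x ^+ 2) * atan v)).
- rewrite atan1 atan0 -EFinD; congr (_%:E).
  have l4 : ln 4 = 2 * ln 2 :> R.
    have -> : 4 = 2 ^+ 2 :> R by rewrite -natrX.
    by rewrite lnXn// mulr_natl.
  have l2 : ln (x ^+ 2) = 2 * ln x by rewrite lnXn// mulr_natl.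
  by rewrite lnM ?posrE ?exprn_gt0// l4 l2; field.
- exact: ler01.
- move=> v _; apply: (is_derive1_cast (is_deriveZ (- ln (4 * x ^+ 2)) (is_derive1_atan v))).
  by [].
- move=> v _; rewrite /prop_for /continuous_at; continuity_tac.
  by rewrite gt_eqF.
Qed.

(** Here 1 + v^2 <= 2 <= 4 x^2. *)
Lemma logslope_high x : 1 / Num.sqrt 2 <= x -> logslope x = 0%E.
Proof.
move=> x2; have s2 : 0 < Num.sqrt 2 :> R by rewrite sqrtr_gt0.
have x0 : 0 < x by apply: lt_le_trans x2; rewrite divr_gt0.
have x22 : 1 <= 2 * x ^+ 2.
  rewrite -(sqr_sqrtr (_ : 0 <= 2 :> R))// -exprMn.
  rewrite exprn_ege1// mulrC -ler_pdivrMr//.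
apply: integral0_eq => v; rewrite /= in_itv/= => /andP[v0 v1].
rewrite max_l ?mul0r//; apply: ln_le0.
rewrite ler_pdivrMr ?mulr_gt0 ?exprn_gt0// mul1r.
have : v ^+ 2 <= 1 by rewrite expr_le1// ltW.
by move=> ?; lra.
Qed.

(** The logarithm in the integrand changes sign where 1 + v^2 = 4 x^2, that is,
    at v = a with cos (atan a) = 1 / (2 x). *)
Lemma logslope_mid x : 1 / 2 < x < 1 / Num.sqrt 2 ->
  logslope x = (- \int[mu]_(theta in `[acos (1 / (2 * x)), pi / 4])
     ln (4 * x ^+ 2 * cos theta ^+ 2))%:E.
Proof.
move=> /andP[x12 xs2]; have pi0 := @pi_gt0 R.
have s2 : 0 < Num.sqrt 2 :> R by rewrite sqrtr_gt0.
have x0 : 0 < x by lra.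
have x22 : 2 * x ^+ 2 < 1.
  rewrite -(sqr_sqrtr (_ : 0 <= 2 :> R))// -exprMn.
  rewrite expr_lt1// ?mulr_ge0 ?(ltW x0) ?(ltW s2)//.
  by rewrite mulrC -ltr_pdivlMr.
have q0 : 0 < 1 / (2 * x) by rewrite divr_gt0// mulr_gt0.
have q1 : 1 / (2 * x) < 1 by rewrite ltr_pdivrMr ?mulr_gt0// mul1r; lra.
set th := acos (1 / (2 * x)).
have cth : cos th = 1 / (2 * x) by rewrite acosK// in_itv/=; lra.
have th0 : 0 < th by apply: acos_gt0; lra.
have thpi : th <= pi by apply: acos_lepi; lra.
have th4 : th < pi / 4.
  rewrite ltNge; apply/negP => h.
  have : cos th <= cos (pi / 4).
    by rewrite leNgt ltr_cos -?leNgt// in_itv/=; lra.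
  have c4 : 0 < cos (pi / 4 : R) by apply: cos_gt0_pihalf; lra.
  rewrite cth => /(lerXn2r 2); rewrite !nnegrE (ltW q0) (ltW c4) => /(_ isT isT).
  rewrite cos_pi4_sqr expr_div_n expr1n exprMn -natrX ler_pdivrMr ?mulr_gt0 ?exprn_gt0//.
  by move=> ?; lra.
pose a := tan th.
have cth0 : cos th != 0 by rewrite cth gt_eqF.
have a2 : 1 + a ^+ 2 = 4 * x ^+ 2.
  rewrite -cos2_tan2// cth expr_div_n expr1n div1r invrK exprMn -natrX//.
have a0 : 0 < a by rewrite -tan0 ltr_tan ?in_itv/=; lra.
have a1 : a < 1 by rewrite -tan_piquarter ltr_tan ?in_itv/=; lra.
have atana : atan a = th by rewrite tanK// in_itv/=; lra.
pose G (y : R) := - ln (4 * x ^+ 2 * cos y ^+ 2).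
have x4 : 0 < 4 * x ^+ 2 by rewrite mulr_gt0// exprn_gt0.
have cosy y : y \in `[th, pi / 4] -> 0 < cos y.
  by rewrite in_itv/= => /andP[? ?]; apply: cos_gt0_pihalf; lra.
have cG y : y \in `[th, pi / 4] -> {for y, continuous G}.
  move=> /cosy cy; rewrite /prop_for /continuous_at /G; continuity_tac.
  by rewrite !mulr_gt0// exprn_gt0.
have lslope : logslope x = (\int[mu]_(v in `[a, 1%R]) (G (atan v) * (1 + v ^+ 2)^-1)%:E)%E.
  rewrite /logslope [LHS]integral_mkcond [RHS]integral_mkcond.
  apply: eq_integral => v _; rewrite !patchE !mem_setE !in_itv/=.
  have Gv : G (atan v) = ln ((1 + v ^+ 2) / (4 * x ^+ 2)).
    rewrite /G cos_atan exprVn sqr_sqrtr ?(ltW (oneDsqr_pos v))//.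
    by rewrite ln_div ?posrE// ln_div ?posrE//; ring.
  rewrite andbC; case: (leP v 1) => v1; last by rewrite andbF.
  rewrite andbT andTb; case: (leP a v) => av.
    rewrite (lt_le_trans a0 av) Gv max_r//; apply: ln_ge0.
    rewrite ler_pdivlMr// mul1r -a2 lerD2l lerXn2r// ?nnegrE; lra.
  case: ltP => // v0; rewrite max_l ?mul0r//; apply: ln_le0.
  by rewrite ler_pdivrMr// mul1r -a2 lerD2l lerXn2r// ?nnegrE; lra.
have cat : continuous (derive1 (@atan R)).
  have -> : derive1 (@atan R) = fun v => (1 + v ^+ 2)^-1 by apply/funext => v; rewrite derive1_atan.
  by move=> v; rewrite /continuous_at; continuity_tac; rewrite gt_eqF.
have sub : (\int[mu]_(y in `[th, (pi / 4)%R]) (G y)%:E = logslope x)%E.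
  rewrite lslope -atana -atan1 (@integration_by_substitution_increasing _ (@atan R) G a 1).
  - apply: eq_integral => v _; congr (_%:E).
    by rewrite -derive1_atan.
  - exact: ltW.
  - by move=> u v _ _; exact: lt_atan.
  - by move=> v _; exact: cat.
  - by apply: cvgP; apply: cvg_at_right_filter; exact: cat.
  - by apply: cvgP; apply: cvg_at_left_filter; exact: cat.
  - split.
    + by move=> v _; exact: derivable_atan.
    + by apply: cvg_at_right_filter; exact: continuous_atan.
    + by apply: cvg_at_left_filter; exact: continuous_atan.
  - rewrite atan1 atana; apply: within_continuous_pt; exact: cG.
rewrite -sub.
have G0 y : y \in `[th, pi / 4] -> 0 <= G y.
  move=> yth; have cy := cosy y yth; rewrite oppr_ge0; apply: ln_le0.
  move: yth; rewrite in_itv/= => /andP[thy ypi].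
  have : cos y <= cos th.
    by rewrite leNgt ltr_cos -?leNgt// in_itv/=; lra.
  move=> /(lerXn2r 2); rewrite !nnegrE cth (ltW q0) (ltW cy) => /(_ isT isT).
  rewrite expr_div_n expr1n exprMn -natrX ler_pdivlMr ?mulr_gt0 ?exprn_gt0//.
  by move=> ?; lra.
have iG : mu.-integrable `[th, pi / 4] (EFin \o G).
  apply: continuous_compact_integrable; first exact: segment_compact.
  exact: within_continuous_pt.
have fG : (\int[mu]_(y in `[th, (pi / 4)%R]) (G y)%:E)%E \is a fin_num.
  exact: integrable_fin_num iG.
rewrite /Rintegral.
have -> : (\int[mu]_(y in `[th, (pi / 4)%R]) (ln (4 * x ^+ 2 * cos y ^+ 2))%:E =
    - \int[mu]_(y in `[th, (pi / 4)%R]) (G y)%:E)%E.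
  rewrite -integral_ge0N; last by move=> y yth; rewrite lee_fin G0.
  by apply: eq_integral => y _; rewrite /G -EFinN opprK.
by rewrite fineN opprK fineK.
Qed.

End log_integrals.

(** * The density of xi *)

Section density.
Context {R : realType}.
Local Notation mu := (@lebesgue_measure R).
Implicit Types x : R.

Lemma inv_sqrt2_bounds : (1 / 2 : R) < 1 / Num.sqrt (2 : R) < (1 : R).
Proof.
have s2 : 0 < Num.sqrt 2 :> R by rewrite sqrtr_gt0.
have s22 : Num.sqrt 2 ^+ 2 = 2 :> R by rewrite sqr_sqrtr.
have s1 : 1 < Num.sqrt 2 :> R by rewrite -[X in X < _](sqrtr1 R) ltr_sqrt// ltr1n.
have s3 : Num.sqrt 2 < 2 :> R.
  by rewrite -[X in _ < X]s22 expr2 ltr_pMr.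
by rewrite !div1r ltf_pV2 ?posrE// s3 invf_lt1.
Qed.

Lemma xi_density_out x : ~~ (0 < x < 1) -> xi_density x = 0.
Proof.
move=> x01; have /andP[s12 s1] := inv_sqrt2_bounds; rewrite /xi_density.
have -> : (0 < x < 1 / 2) = false.
  by apply: contraNF x01 => /andP[x0 x1]; rewrite x0/=; lra.
have -> : (1 / 2 < x < 1 / Num.sqrt 2) = false.
  by apply: contraNF x01 => /andP[x0 x1]; apply/andP; split; lra.
by rewrite !mul0r addr0 mulr0.
Qed.

(** Both ranges in the definition of the density exclude 1/2, where [logslope]
    is positive: the two functions must be compared away from this point. *)
Lemma xi_density_half : xi_density (1 / 2) = 0 :> R.
Proof. by rewrite /xi_density !ltxx andbF !mul0r addr0 mulr0. Qed.

Lemma xi_density_in x : 0 < x < 1 -> x != 1 / 2 ->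
  logslope x \is a fin_num /\ xi_density x =
    6 * x / (catalan R * (1 - x ^+ 2) ^+ 2) * fine (logslope x).
Proof.
move=> /andP[x0 x1] x12; have /andP[s12 s1] := inv_sqrt2_bounds.
rewrite /xi_density.
have [xl|xr] := ltP x (1 / 2).
  have xl' : 0 < x < 1 / 2 by rewrite x0.
  rewrite (logslope_low _ xl') x0 (lt_gtF xl); split; first by [].
  by rewrite /= mul0r addr0 mul1r mulNr mulrN.
have {}xr : 1 / 2 < x by rewrite lt_neqAle eq_sym x12.
rewrite xr andbF mul0r add0r; have [xs|xs] := ltP x (1 / Num.sqrt 2).
  have xm : 1 / 2 < x < 1 / Num.sqrt 2 by rewrite xr.
  rewrite (logslope_mid _ xm); split; first by [].
  by set J := Rintegral _ _ _; rewrite /= mul1r mulNr mulrN.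
rewrite logslope_high//; split; first by [].
by rewrite mul0r !mulr0.
Qed.

Hypothesis C0 : 0 < catalan R.

Let factor_ge0 x : 0 < x < 1 -> 0 <= 6 * x / (catalan R * (1 - x ^+ 2) ^+ 2).
Proof.
move=> /andP[x0 _].
by apply: divr_ge0; rewrite mulr_ge0 ?sqr_ge0// ltW.
Qed.

Lemma xi_density_ge0 x : 0 <= xi_density x.
Proof.
have [x01|/xi_density_out ->//] := boolP (0 < x < 1).
have [->|x12] := eqVneq x (1 / 2); first by rewrite xi_density_half.
have [_ ->] := xi_density_in x x01 x12.
by rewrite mulr_ge0 ?factor_ge0// fine_ge0// logslope_ge0.
Qed.

Lemma measurable_xi_density : measurable_fun [set: R] (@xi_density R).
Proof.
have -> : @xi_density R = fun x =>
  ((0 < x) && (x < 1))%R%:R * (x != 1 / 2)%:R *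
    (6 * x / (catalan R * (1 - x ^+ 2) ^+ 2)) * fine (logslope x).
  apply/funext => x; have [x01|x01] := boolP (0 < x < 1); last first.
    by rewrite xi_density_out// !mul0r.
  have [->|x12] := eqVneq x (1 / 2).
    by rewrite xi_density_half mulr0 !mul0r.
  by rewrite !mul1r; have [_ ->] := xi_density_in x x01 x12.
apply: measurable_funM; last first.
  by apply: (measurableT_comp (fine_measurable measurableT)); exact: measurable_logslope.
apply: measurable_funM; last by measurability_tac.
apply: measurable_funM; first by measurability_tac.
apply: measurable_natr_bool; apply: measurable_neg.
by apply: measurable_fun_eqr; measurability_tac.
Qed.

Lemma integral_xi_density (A : set R) : measurable A ->
  (\int[mu]_(x in A) (xi_density x)%:E =
   (3 / catalan R)%:E * lattice_mass A)%E.
Proof.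
move=> mA; rewrite lattice_massE//.
have mg : measurable_fun [set: R] (fun x =>
    (2 * x / (1 - x ^+ 2) ^+ 2 * \1_A x)%:E * logslope x)%E.
  apply: emeasurable_funM; last exact: measurable_logslope.
  apply/measurable_EFinP; apply: measurable_funM; first by measurability_tac.
  exact: measurable_indic.
have mD : measurable (`]0%R, 1%R[ `\ (1 / 2 : R)).
  by apply: measurableD => //; exact: measurable_set1.
rewrite -(@integral_setD1 _ _ (1 / 2 : R) _ mD (measurable_funTS mg)).
have C3 : 0 <= 3 / catalan R by rewrite divr_ge0// ltW.
rewrite -ge0_integralZl_EFin//; last 2 first.
- move=> x [] /=; rewrite in_itv/= => /andP[x0 _] _.
  rewrite mule_ge0 ?logslope_ge0// lee_fin mulr_ge0// divr_ge0 ?sqr_ge0//.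
  by rewrite mulr_ge0// ltW.
- exact: measurable_funTS.
rewrite [LHS]integral_mkcond [RHS]integral_mkcond; apply: eq_integral => x _.
rewrite !patchE; case: ifPn => xA; case: ifPn => xD.
- move: xD; rewrite inE/= in_itv/= => -[x01 /eqP x12].
  have [fl ->] := xi_density_in x x01 x12.
  rewrite indicE xA mulr1 muleA -EFinM [LHS]EFinM fineK//; congr (_%:E * _)%E.
  have [x0 x1] := andP x01.
  have w0 : 0 < 1 - x ^+ 2 by rewrite subr_gt0 expr_lt1// ltW.
  by field; rewrite !gt_eqF.
- suff -> : xi_density x = 0 by [].
  have [x01|/xi_density_out//] := boolP (0 < x < 1).
  have [->|x12] := eqVneq x (1 / 2); first by rewrite xi_density_half.
  by move/negP: xD; case; rewrite inE/= in_itv/= x01; split => //; apply/eqP.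
- by rewrite indicE (negbTE xA) mulr0 mul0e mule0.
- by [].
Qed.

End density.

Theorem corollary18 (R : realType) (d : measure_display)
    (T : measurableType d) (P : probability T R) (t y1 y2 : T -> R) (c : R)
    (density_ty : has_density P (leb3 R) (fun w => (t w, y1 w, y2 w))
       (fun u => c * u.1.1 * \1_(@lattice_domain R) u)) :
  has_density P (@lebesgue_measure R) (fun w => xi (t w) (y1 w) (y2 w))
    (@xi_density R).
Proof.
have mass1 : c * (catalan R / 3) = 1.
  have := law_lattice_mass density_ty measurableT.
  rewrite preimage_setT probability_setT lattice_massT_catalan -EFinM.
  by move=> -[].
have c0 := density_constant_ge0 density_ty.
(* c >= 0 and c * (C / 3) = 1 force the sign of C *)
have C0 : 0 < catalan R.
  rewrite ltNge; apply/negP => C0; have : c * (catalan R / 3) <= 0.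
    by rewrite mulr_ge0_le0// ler_pdivrMr// mul0r.
  by rewrite mass1 ler10.
have cE : c = 3 / catalan R.
  have C0' : catalan R != 0 by rewrite gt_eqF.
  by apply: (mulIf (x := catalan R / 3)); [rewrite mulf_neq0|rewrite mass1; field].
have [mX _ _ _] := density_ty.
split.
- exact: (measurableT_comp measurable_xi mX).
- exact: measurable_xi_density.
- exact: xi_density_ge0.
- move=> A mA; rewrite integral_xi_density// -cE.
  exact: (law_lattice_mass density_ty mA).
Qed.
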